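(* Let $m=2$, let $n=2\tilde n+1$ with $\tilde n\in\mathbb{N}$, $\tilde n\ge 1$ (so $n$ is odd and $n\neq 1$), and let $1+c=\frac1n$. Let $x,y\in\mathbb{R}^2\setminus\{0\}$, $z=|x||y|$, $w=\frac{\langle x,y\rangle}{z}$. Let $K_2^c(t)=K_2^c(x,y;t)$ be the kernel of the radially deformed Fourier transform with auxiliary variable $t$ (defined in the context). Then, for $\mathrm{Re}\,s$ sufficiently large and with $r=\sqrt{s^2+z^2}$, its Laplace transform with respect to $t$ is $$\begin{aligned}\mathcal{L}\left(K_{2}^c\right)(s)&=\frac{1}{r}\,\frac{(s+r)^{\tilde{n}+1}+(-1)^{\tilde{n}}(r-s)^{\tilde{n}+1}}{(s+r)^n-2w(-iz)^n+(-1)^{n}(r-s)^n}\\&\quad+wz\,\frac{i}{r}\,\frac{(-1)^{\tilde{n}}(r-s)^{\tilde{n}}-(s+r)^{\tilde{n}}}{(s+r)^n-2w(-iz)^n+(-1)^{n}(r-s)^n}\\&\quad+(\underline{x}\wedge\underline{y})\,\frac{i}{r}\,\frac{(-1)^{\tilde{n}}(r-s)^{\tilde{n}}-(s+r)^{\tilde{n}}}{(s+r)^n-2w(-iz)^n+(-1)^n(r-s)^n}.\end{aligned}$$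
   Context: The Clifford algebra $\mathcal{C}\ell_{0,m}$ (complexified) is generated by $e_1,\dots,e_m$ with $e_ie_j+e_je_i=-2\delta_{ij}$. For $x,y\in\mathbb{R}^m$, $\underline{x}\wedge\underline{y}:=\sum_{j<k}e_je_k(x_jy_k-x_ky_j)$. $J_\nu$ is the Bessel function of the first kind. The Laplace transform is $\mathcal{L}(f)(s)=\int_0^\infty e^{-st}f(t)\,dt$, applied coefficientwise to Clifford-algebra-valued functions. $\sqrt{s^2+z^2}$ is the branch analytic on $\mathrm{Re}\,s>0$ and positive for $s>0$. The radially deformed Fourier transform is $\mathcal{F}_D=e^{i\frac{\pi}{2}\left(\frac12+\frac{m-1}{2(1+c)}\right)}e^{\frac{-i\pi}{4(1+c)^2}\left(\mathbf{D}^2-(1+c)^2\underline{x}^2\right)}$, with $\mathbf{D}=\partial_{\underline{x}}+c|x|^{-2}\underline{x}\,\mathbb{E}$, where $\partial_{\underline x}=\sum_j e_j\partial_{x_j}$, $\underline x=\sum_j e_jx_j$, $\mathbb{E}=\sum_j x_j\partial_{x_j}$. It is an integral transform whose kernel $K_m^c(x,y)$ has a known explicit series expansion. For $m=2$ and $1+c=\frac1n$, $n=2\tilde n+1$, inserting an auxiliary variable $t>0$ in the Bessel functions of that series gives the following, which is taken as the definition of the kernel (the original kernel is recovered at $t=1$). With $\theta=\arccos w$, $$K_2^c(t)=K_{2,scal}^c(t)+(\underline{x}\wedge\underline{y})\,K_{2,biv}^c(t),$$ $$K_{2,scal}^c(t)=z^{-\tilde n}\sum_{k=0}^{\infty}(-i)^{kn}J_{kn+\tilde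 n}(zt)\cos(k\theta)+(-1)^{\tilde n}z^{-\tilde n}\sum_{k=1}^{\infty}(-i)^{kn}J_{kn-\tilde n}(zt)\cos(k\theta),$$ $$K_{2,biv}^c(t)=-z^{-\tilde n-1}\sum_{k=1}^{\infty}(-i)^{kn}J_{kn+\tilde n}(zt)\frac{\sin(k\theta)}{\sin\theta}+(-1)^{\tilde n}z^{-\tilde n-1}\sum_{k=1}^{\infty}(-i)^{kn}J_{kn-\tilde n}(zt)\frac{\sin(k\theta)}{\sin\theta},$$ where $\sin(k\theta)/\sin\theta$ is understood by continuity when $\sin\theta=0$. *)

(* Defs.v *)
From Stdlib Require Import Reals Lra Psatz Factorial.
From Coquelicot Require Import Coquelicot.

Local Open Scope C_scope.

(** * The complexified Clifford algebra Cl_{0,2} *)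

(** Coordinates with respect to the basis 1, e1, e2, e1 e2. *)
Record Cl02 : Type := mkCl { cl_0 : C; cl_1 : C; cl_2 : C; cl_12 : C }.

Definition cl_plus (a b : Cl02) : Cl02 :=
  mkCl (cl_0 a + cl_0 b) (cl_1 a + cl_1 b) (cl_2 a + cl_2 b)
       (cl_12 a + cl_12 b).

Definition cl_scal (l : C) (a : Cl02) : Cl02 :=
  mkCl (l * cl_0 a) (l * cl_1 a) (l * cl_2 a) (l * cl_12 a).

(** The bilinear extension of the multiplication table given by
    e1 e1 = e2 e2 = -1 and e2 e1 = - e1 e2 (hence (e1 e2)(e1 e2) = -1,
    e1 (e1 e2) = - e2, (e1 e2) e1 = e2, e2 (e1 e2) = e1, (e1 e2) e2 = - e1). *)
Definition cl_mult (a b : Cl02) : Cl02 :=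
  let 'mkCl a0 a1 a2 a3 := a in
  let 'mkCl b0 b1 b2 b3 := b in
  mkCl (a0 * b0 - a1 * b1 - a2 * b2 - a3 * b3)
       (a0 * b1 + a1 * b0 + a2 * b3 - a3 * b2)
       (a0 * b2 + a2 * b0 - a1 * b3 + a3 * b1)
       (a0 * b3 + a3 * b0 + a1 * b2 - a2 * b1).

Definition cl_of_C (l : C) : Cl02 := mkCl l 0 0 0.
Definition cl_e1 : Cl02 := mkCl 0 1 0 0.
Definition cl_e2 : Cl02 := mkCl 0 0 1 0.

Lemma cl_mult_assoc (a b d : Cl02) :
  cl_mult a (cl_mult b d) = cl_mult (cl_mult a b) d.
Proof. destruct a, b, d; simpl; f_equal; ring. Qed.

Lemma cl_mult_1_l (a : Cl02) : cl_mult (cl_of_C 1) a = a.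
Proof. destruct a; simpl; f_equal; ring. Qed.

Lemma cl_mult_1_r (a : Cl02) : cl_mult a (cl_of_C 1) = a.
Proof. destruct a; simpl; f_equal; ring. Qed.

Lemma cl_mult_of_C_l (l : C) (a : Cl02) : cl_mult (cl_of_C l) a = cl_scal l a.
Proof. destruct a; unfold cl_scal; simpl; f_equal; ring. Qed.

Lemma cl_mult_of_C_r (l : C) (a : Cl02) : cl_mult a (cl_of_C l) = cl_scal l a.
Proof. destruct a; unfold cl_scal; simpl; f_equal; ring. Qed.

Lemma cl_e1_sqr : cl_mult cl_e1 cl_e1 = cl_of_C (-1).
Proof. unfold cl_of_C; simpl; f_equal; ring. Qed.

Lemma cl_e2_sqr : cl_mult cl_e2 cl_e2 = cl_of_C (-1).
Proof. unfold cl_of_C; simpl; f_equal; ring. Qed.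

Lemma cl_e1_e2_anticomm :
  cl_plus (cl_mult cl_e1 cl_e2) (cl_mult cl_e2 cl_e1) = cl_of_C 0.
Proof. unfold cl_of_C, cl_plus; simpl; f_equal; ring. Qed.

(** * The plane *)

Definition dot2 (x y : R * R) : R := (fst x * fst y + snd x * snd y)%R.
Definition norm2 (x : R * R) : R := sqrt (dot2 x x).

Definition wedge (x y : R * R) : Cl02 :=
  cl_scal (RtoC (fst x * snd y - snd x * fst y)) (cl_mult cl_e1 cl_e2).

(** * Bessel functions, the kernel, and the Laplace transform *)

(** Only natural orders k occur, for which Gamma (p + k + 1) = (p + k)!. *)
Definition BesselJ (k : nat) (u : R) : R :=
  Series (fun p => (-1) ^ p / (INR (fact p) * INR (fact (p + k)))
                   * (u / 2) ^ (2 * p + k))%R.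

(** A complex series is summed through its real and imaginary parts. *)
Definition CSeries (a : nat -> C) : C :=
  (Series (fun k => Re (a k)), Series (fun k => Im (a k))).

(** sin (k theta) / sin theta, extended by continuity to the zeros of sin
    ([Lim] is a limit over punctured neighbourhoods). *)
Definition sin_quot (k : nat) (theta : R) : R :=
  if Req_EM_T (sin theta) 0
  then real (Lim (fun phi => sin (INR k * phi) / sin phi)%R theta)
  else (sin (INR k * theta) / sin theta)%R.

(** In the sums over k >= 1, reindexed by k = S j, the subtraction k n - nt
    is not truncated as soon as nt <= n. *)
Definition K2_scal (n nt : nat) (z theta t : R) : C :=
  / RtoC z ^ nt
    * CSeries (fun k => (- Ci) ^ (k * n) * RtoC (BesselJ (k * n + nt) (z * t))
                        * RtoC (cos (INR k * theta)))
  + (-1) ^ nt * / RtoC z ^ nt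
    * CSeries (fun j => let k := S j in
                        (- Ci) ^ (k * n) * RtoC (BesselJ (k * n - nt) (z * t))
                        * RtoC (cos (INR k * theta))).

Definition K2_biv (n nt : nat) (z theta t : R) : C :=
  - / RtoC z ^ (nt + 1)
    * CSeries (fun j => let k := S j in
                        (- Ci) ^ (k * n) * RtoC (BesselJ (k * n + nt) (z * t))
                        * RtoC (sin_quot k theta))
  + (-1) ^ nt * / RtoC z ^ (nt + 1)
    * CSeries (fun j => let k := S j in
                        (- Ci) ^ (k * n) * RtoC (BesselJ (k * n - nt) (z * t))
                        * RtoC (sin_quot k theta)).

(** The kernel for 1 + c = 1 / n and n = 2 nt + 1. *)
Definition K2 (n nt : nat) (x y : R * R) (t : R) : Cl02 :=
  let z := (norm2 x * norm2 y)%R in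
  let theta := acos (dot2 x y / z)%R in
  cl_plus (cl_of_C (K2_scal n nt z theta t))
          (cl_mult (wedge x y) (cl_of_C (K2_biv n nt z theta t))).

Definition Cexp (u : C) : C := (exp (Re u) * cos (Im u), exp (Re u) * sin (Im u))%R.

(** [is_Laplace f s l]: the integral of e^{-st} f(t) over [0, +oo) converges
    and has the value l. *)
Definition is_Laplace (f : R -> C) (s l : C) : Prop :=
  is_RInt_gen (V := C_R_NormedModule) (fun t => Cexp (- (s * RtoC t)) * f t)
    (at_point 0) (Rbar_locally p_infty) l.

Definition is_Laplace_Cl (f : R -> Cl02) (s : C) (l : Cl02) : Prop :=
  is_Laplace (fun t => cl_0 (f t)) s (cl_0 l) /\
  is_Laplace (fun t => cl_1 (f t)) s (cl_1 l) /\
  is_Laplace (fun t => cl_2 (f t)) s (cl_2 l) /\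
  is_Laplace (fun t => cl_12 (f t)) s (cl_12 l).

(** * The square root of s^2 + z^2 on the right half-plane *)

Definition is_sqrt_branch (z : R) (r : C -> C) : Prop :=
  (forall s : C, (0 < Re s)%R -> r s ^ 2 = s ^ 2 + RtoC z ^ 2) /\
  (forall s : C, (0 < Re s)%R ->
     ex_derive (K := C_AbsRing) (V := C_NormedModule) r s) /\
  (forall a : R, (0 < a)%R -> Im (r (RtoC a)) = 0%R /\ (0 < Re (r (RtoC a)))%R).

Lemma Csqrt_exists (u : C) : { p : C | p ^ 2 = u /\ (0 <= Re p)%R }.
Proof.
destruct u as [a b].
set (m := sqrt (a ^ 2 + b ^ 2)).
assert (Hs : (0 <= a ^ 2 + b ^ 2)%R) by nra.
assert (Hm : (m * m = a ^ 2 + b ^ 2)%R) by (apply sqrt_sqrt; exact Hs).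
assert (Hm0 : (0 <= m)%R) by apply sqrt_pos.
assert (H1 : (0 <= (m + a) / 2)%R) by nra.
assert (H2 : (0 <= (m - a) / 2)%R) by nra.
set (p1 := sqrt ((m + a) / 2)). set (p2 := sqrt ((m - a) / 2)).
assert (P1 : (p1 * p1 = (m + a) / 2)%R) by (apply sqrt_sqrt; exact H1).
assert (P2 : (p2 * p2 = (m - a) / 2)%R) by (apply sqrt_sqrt; exact H2).
assert (Q1 : (0 <= p1)%R) by apply sqrt_pos.
assert (Q2 : (0 <= p2)%R) by apply sqrt_pos.
assert (P12 : ((2 * (p1 * p2)) * (2 * (p1 * p2)) = b * b)%R).
{ replace ((2 * (p1 * p2)) * (2 * (p1 * p2)))%R
    with (4 * (p1 * p1) * (p2 * p2))%R by ring.
  rewrite P1, P2. nra. }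
assert (Q12 : (0 <= p1 * p2)%R) by nra.
destruct (Rle_dec 0 b) as [Hb | Hb].
- exists (p1, p2). split; [| exact Q1].
  apply injective_projections; simpl; nra.
- exists (p1, - p2)%R. split; [| exact Q1].
  apply injective_projections; simpl; nra.
Qed.

Lemma sqrt_branch_exists (z : R) : exists r : C -> C, is_sqrt_branch z r.
Proof.
set (p s := proj1_sig (Csqrt_exists (s ^ 2 + RtoC z ^ 2))).
assert (Hp2 : forall s, p s ^ 2 = s ^ 2 + RtoC z ^ 2)
  by (intros s; apply (proj2_sig (Csqrt_exists _))).
assert (Hp0 : forall s, (0 <= Re (p s))%R)
  by (intros s; apply (proj2_sig (Csqrt_exists _))).
assert (Hpos : forall s, (0 < Re s)%R -> (0 < Re (p s))%R).
{ intros s Hs. destruct (Hp0 s) as [H | H]; [exact H | exfalso].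
  generalize (Hp2 s). destruct (p s) as [u v], s as [a b].
  simpl in *. unfold Cmult, Cplus; simpl. intros E.
  injection E. intros E2 E1. subst u.
  assert (Hb : b = 0%R) by nra. subst b. nra. }
exists p. split; [| split].
- intros s _. apply Hp2.
- intros s Hs. exists (s / p s).
  specialize (Hpos s Hs).
  set (q := Re (p s)) in *.
  assert (Hre : forall u : C, (Re u <= Cmod u)%R).
  { intros u. apply Rle_trans with (Rabs (Re u)); [apply Rle_abs |].
    eapply Rle_trans; [| apply Rmax_Cmod]. apply Rmax_l. }
  assert (Hsum : forall y, (q <= Cmod (p y + p s))%R).
  { intros y. eapply Rle_trans; [| apply Hre].
    generalize (Hp0 y). change (Re (p y + p s)) with (Re (p y) + q)%R. lra. }
  assert (Hps : (q <= Cmod (p s))%R) by apply Hre.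
  set (M := (1 + 2 * Cmod s)%R).
  assert (Ms := Cmod_ge_0 s). assert (Mp := Cmod_ge_0 (p s)).
  set (B := ((Cmod (p s) + Cmod s * (M / q)) / (q * q))%R).
  assert (HB : (0 <= B)%R).
  { unfold B, M. apply Rmult_le_pos.
    - apply Rplus_le_le_0_compat; [lra |].
      apply Rmult_le_pos; [lra |]. apply Rmult_le_pos; [lra |].
      left; apply Rinv_0_lt_compat; lra.
    - left; apply Rinv_0_lt_compat; nra. }
  split; [apply is_linear_scal_l |].
  intros s' Hs'.
  apply (is_filter_lim_locally_unique (V := AbsRing_NormedModule C_AbsRing)) in Hs'.
  subst s'.
  intros eps.
  assert (Hd : (0 < Rmin 1 (eps / (B + 1)))%R).
  { apply Rmin_pos; [lra |]. apply Rdiv_lt_0_compat; [apply cond_pos | lra]. }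
  exists (mkposreal _ Hd). intros y Hy.
  change (Cmod (y - s) < Rmin 1 (eps / (B + 1)))%R in Hy.
  change (Cmod (p y - p s - (y - s) * (s / p s)) <= eps * Cmod (y - s))%R.
  assert (Hy1 : (Cmod (y - s) < 1)%R)
    by (eapply Rlt_le_trans; [apply Hy | apply Rmin_l]).
  assert (Hy2 : (Cmod (y - s) < eps / (B + 1))%R)
    by (eapply Rlt_le_trans; [apply Hy | apply Rmin_r]).
  set (d := Cmod (y - s)) in *.
  assert (Hd0 : (0 <= d)%R) by apply Cmod_ge_0.
  assert (Hn1 : p y + p s <> 0).
  { intros E. generalize (Hsum y). rewrite E, Cmod_0. lra. }
  assert (Hn2 : p s <> 0).
  { intros E. generalize Hps. rewrite E, Cmod_0. lra. }
  assert (Hys : (Cmod (y + s) <= M)%R).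
  { replace (y + s) with ((y - s) + 2 * s) by ring.
    eapply Rle_trans; [apply Cmod_triangle |].
    rewrite Cmod_mult, Cmod_R, Rabs_pos_eq by lra. fold d. unfold M. lra. }
  assert (E1 : p y - p s = (y - s) * ((y + s) / (p y + p s))).
  { assert (E0 : (p y - p s) * (p y + p s) = (y - s) * (y + s)).
    { transitivity (p y ^ 2 - p s ^ 2); [simpl; ring |].
      rewrite !Hp2. simpl; ring. }
    transitivity ((p y - p s) * (p y + p s) / (p y + p s));
      [field; exact Hn1 |]. rewrite E0. field; exact Hn1. }
  assert (Hi : (/ Cmod (p y + p s) <= / q)%R)
    by (apply Rinv_le_contravar; [lra | apply Hsum]).
  assert (Hi' : (/ Cmod (p s) <= / q)%R)
    by (apply Rinv_le_contravar; [lra | exact Hps]).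
  assert (Hi0 : (0 < / q)%R) by (apply Rinv_0_lt_compat; lra).
  assert (L1 : (Cmod (p y - p s) <= d * (M / q))%R).
  { rewrite E1, Cmod_mult, Cmod_div by exact Hn1. fold d.
    apply Rmult_le_compat_l; [exact Hd0 |].
    apply Rmult_le_compat; try apply Cmod_ge_0; auto.
    left; apply Rinv_0_lt_compat. generalize (Hsum y); lra. }
  assert (E2 : p y - p s - (y - s) * (s / p s) =
     (y - s) * (((y - s) * p s - s * (p y - p s)) / ((p y + p s) * p s))).
  { rewrite E1 at 1. field. split; [exact Hn2 | exact Hn1]. }
  rewrite E2, Cmod_mult. fold d. rewrite (Rmult_comm eps).
  apply Rmult_le_compat_l; [exact Hd0 |].
  rewrite Cmod_div by (apply Cmult_neq_0; assumption).
  apply Rle_trans with (d * B)%R.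
  + unfold B.
    replace (d * ((Cmod (p s) + Cmod s * (M / q)) / (q * q)))%R
      with ((d * Cmod (p s) + Cmod s * (d * (M / q))) * (/ (q * q)))%R
      by (field; lra).
    apply Rmult_le_compat; try apply Cmod_ge_0.
    * left; apply Rinv_0_lt_compat. rewrite Cmod_mult.
      generalize (Hsum y); nra.
    * eapply Rle_trans; [apply Cmod_triangle |].
      rewrite Cmod_opp, !Cmod_mult. fold d.
      apply Rplus_le_compat_l. apply Rmult_le_compat_l; assumption.
    * apply Rinv_le_contravar; [nra |]. rewrite Cmod_mult.
      generalize (Hsum y); nra.
  + apply Rmult_lt_compat_r with (r := (B + 1)%R) in Hy2; [| lra].
    replace (eps / (B + 1) * (B + 1))%R with (pos eps) in Hy2 by (field; lra).
    nra.
- intros a Ha.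
  assert (H : (0 < Re (p (RtoC a)))%R) by (apply Hpos; exact Ha).
  split; [| exact H].
  generalize (Hp2 (RtoC a)) H. destruct (p (RtoC a)) as [u v].
  simpl. unfold Cmult, Cplus; simpl. intros E Hu.
  assert (E2 := f_equal snd E). simpl in E2. nra.
Qed.

(* Main.v *)
Require Import Defs.
From Stdlib Require Import Reals Lra Lia Factorial.
From Coquelicot Require Import Coquelicot.

(** On the half-plane Re s > 2 z, term-by-term integration is justified by
    |J_k(u)| <= (4/3) 2^{-k} e^{2u} (u >= 0).  The Laplace transforms L_k of
    J_k(z t), expanded in powers of 1/s, satisfy by Pascal's rule
    L_{k+2} + (2s/z) L_{k+1} = L_k and s L_0 + z L_1 = 1.  The characteristic
    roots are q = (r - s)/z and -1/q with |q| < 1, and L_k -> 0 excludes the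
    second, so L_k = q^k / r.  The kernel sums then become generating functions
    of cos(k theta) and sin(k theta)/sin theta in Q = (-i q)^n, with denominator
    1 - 2 w Q + Q^2.  When sin theta = 0 the bivector x ^ y vanishes. *)

(** * Dominated series of improper integrals *)

(** Only the power series of the Bessel functions is used. The two recurrences are the transformed
    forms of 2 J_{k+1}' = J_k - J_{k+2} and J_0' = -J_1, but they are read off from the coefficients
    in 1/s, so no J_k is ever differentiated. Choosing the root q needs Re r > 0, whereas the branch
    is specified by analyticity and by its values on the positive axis; the sign is carried to the
    whole half-plane by continuity along vertical segments. With r - s = z q and r + s = z / q, the
    stated denominator equals (r + s)^n (1 - 2 w Q + Q^2). What then remains is an identity between
    rational functions of z, q, w and the powers of exponent [nt], modulo i^2 = -1 and ((-1)^nt)^2 =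
    1. *)

Lemma norm_series_le {V : NormedModule R_AbsRing} (a : nat -> V) (l : V)
    (b : nat -> R) (lb : R) :
  (forall k, norm (a k) <= b k) -> is_series a l -> is_series b lb ->
  norm l <= lb.
Proof.
intros Hab Ha Hb.
apply (filterlim_le (F := eventually) (fun N => norm (sum_n a N)) (sum_n b)
         (Finite (norm l)) (Finite lb)).
- exists 0%nat. intros N _. unfold sum_n.
  eapply Rle_trans; [apply (norm_sum_n_m a 0 N) |].
  apply sum_n_m_le. intros k. apply Hab.
- eapply filterlim_comp; [exact Ha |]. apply filterlim_norm.
- exact Hb.
Qed.

(** Weierstrass test: the distance from a partial sum to S x is the norm of a tail, dominated by the
    tail of the numerical series, which does not depend on x. *)
Lemma sum_n_uniform_limit {V : NormedModule R_AbsRing} {T : Type}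
    (u : nat -> T -> V) (A : nat -> R) (S : T -> V) :
  (forall k x, norm (u k x) <= A k) -> ex_series A ->
  (forall x, is_series (fun k => u k x) (S x)) ->
  filterlim (fun N => (fun x => sum_n (fun k => u k x) N)
                        : fct_UniformSpace T V)
    eventually (locally (S : fct_UniformSpace T V)).
Proof.
intros Hu [B0 HB] HS. set (B := B0 : R). change (is_series A B) in HB.
apply filterlim_locally. intros eps.
assert (HB' := proj1 (filterlim_locally (sum_n A) B) HB eps).
destruct HB' as [N0 HN0]. exists N0. intros N HN x.
specialize (HN0 N HN).
apply (norm_compat1 (V := V)). rewrite <- norm_opp, opp_minus.
apply Rle_lt_trans with (B - sum_n A N)%R.
- apply (norm_series_le (fun k => u (Datatypes.S N + k)%nat x) _
           (fun k => A (Datatypes.S N + k)%nat)).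
  + intros k. apply Hu.
  + apply (is_series_incr_n (fun k => u k x)); [lia |].
    simpl Init.Nat.pred. 
    assert (E : forall p q : V, plus (minus p q) q = p).
    { intros p q. unfold minus. rewrite <- plus_assoc.
      transitivity (plus p zero); [f_equal; apply (plus_opp_l q) | apply plus_zero_r]. }
    rewrite E. apply HS.
  + apply (is_series_incr_n A); [lia |]. simpl Init.Nat.pred.
    refine (eq_ind B (is_series A) HB _ _).
    change (B = B - sum_n A N + sum_n A N :> R). ring.
- change (Rabs (sum_n A N - B) < eps)%R in HN0.
  apply Rabs_def2 in HN0. lra.
Qed.

(** This turns the filter definition into a primitive with a limit at infinity, the form on which
    limits can be exchanged. Integrability up to one large endpoint passes to shorter intervals by
    Chasles. *)
Lemma is_RInt_gen_p_infty_iff {V : CompleteNormedModule R_AbsRing} 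
    (f : R -> V) (a : R) (l : V) :
  is_RInt_gen f (at_point a) (Rbar_locally p_infty) l <->
  exists I : R -> V, (forall b, a <= b -> is_RInt f a b (I b)) /\
    filterlim I (Rbar_locally p_infty) (locally l).
Proof.
split.
- intros H.
  assert (E : forall b, a <= b -> ex_RInt f a b).
  { intros b Hb.
    destruct (H (fun _ => True)) as [P Q HP [M HM] HPQ].
    { exists (mkposreal 1 Rlt_0_1). intros; exact Logic.I. }
    destruct (HPQ a (Rmax M b + 1)%R HP) as [y [Hy _]].
    { apply HM. generalize (Rmax_l M b). lra. }
    apply ex_RInt_Chasles_1 with (Rmax M b + 1)%R.
    - generalize (Rmax_r M b). lra.
    - exists y. exact Hy. }
  exists (fun b => RInt f a b). split.
  + intros b Hb. apply (RInt_correct f), E, Hb.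
  + intros P HP. destruct (H P HP) as [P1 Q HP1 [M HM] HPQ].
    exists (Rmax M a). intros b Hb.
    destruct (HPQ a b HP1) as [y [Hy Py]].
    { apply HM. generalize (Rmax_l M a). lra. }
    simpl in Hy. rewrite (is_RInt_unique _ _ _ _ Hy). exact Py.
- intros [I [HI HL]] P HP. destruct (HL P HP) as [M HM].
  exists (fun x => x = a) (fun b => Rmax M a < b).
  + reflexivity.
  + exists (Rmax M a). intros b Hb. exact Hb.
  + intros x b Hx Hb. rewrite Hx. exists (I b). split.
    * apply HI. generalize (Rmax_r M a). lra.
    * apply HM. generalize (Rmax_l M a). lra.
Qed.

Lemma is_RInt_series {V : CompleteNormedModule R_AbsRing} 
    (g : nat -> R -> V) (G : R -> V) (h : nat -> V)
    (A : nat -> R) (a b : R) :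
  a <= b ->
  (forall k t, a <= t <= b -> norm (g k t) <= A k) -> ex_series A ->
  (forall t, a <= t <= b -> is_series (fun k => g k t) (G t)) ->
  (forall k, is_RInt (g k) a b (h k)) ->
  exists I, is_series h I /\ is_RInt G a b I.
Proof.
intros Hab Hg HA HG Hh.
(* The bounds hold on [a, b] only, while uniform convergence is over all of R; composing with the
   projection onto [a, b] reconciles the two and changes nothing on the interval. *)
set (clamp t := Rmax a (Rmin b t)).
assert (Hc : forall t, a <= clamp t <= b).
{ intros t. unfold clamp. split; [apply Rmax_l |].
  apply Rmax_lub; [exact Hab | apply Rmin_l]. }
assert (Hid : forall t, a <= t <= b -> clamp t = t).
{ intros t Ht. unfold clamp. rewrite Rmin_right by lra. apply Rmax_right; lra. }
destruct (filterlim_RInt (V := V)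
            (fun N t => sum_n (fun k => g k (clamp t)) N) a b eventually _
            (fun t => G (clamp t)) (fun N => sum_n h N)) as [I [HI1 HI2]].
- intros N. induction N as [|N IH].
  + apply is_RInt_ext with (g 0%nat).
    * intros t Ht. rewrite Rmin_left, Rmax_right in Ht by lra.
      rewrite sum_O, Hid by lra. reflexivity.
    * rewrite sum_O. apply Hh.
  + apply is_RInt_ext with
      (fun t => plus (sum_n (fun k => g k (clamp t)) N) (g (S N) t)).
    * intros t Ht. rewrite Rmin_left, Rmax_right in Ht by lra.
      rewrite sum_Sn, (Hid t) by lra. reflexivity.
    * rewrite sum_Sn. apply (is_RInt_plus (V := V)); [exact IH | apply Hh].
- apply (sum_n_uniform_limit (fun k t => g k (clamp t)) A).
  + intros k t. apply Hg, Hc.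
  + exact HA.
  + intros t. apply HG, Hc.
- exists I. split; [exact HI1 |].
  apply is_RInt_ext with (fun t => G (clamp t)); [| exact HI2].
  intros t Ht. rewrite Rmin_left, Rmax_right in Ht by lra.
  rewrite Hid by lra. reflexivity.
Qed.

Lemma is_RInt_exp_neg (A al b : R) : 0 < al ->
  is_RInt (fun t => A * exp (- al * t))%R 0 b (A * (1 - exp (- al * b)) / al)%R.
Proof.
intros Hal.
replace (A * (1 - exp (- al * b)) / al)%R
  with (minus (- (A / al) * exp (- al * b)) (- (A / al) * exp (- al * 0)))%R.
2:{ unfold minus, plus, opp; simpl. rewrite Rmult_0_r, exp_0. field. lra. }
apply (is_RInt_derive (fun t => - (A / al) * exp (- al * t))%R).
- intros t _. auto_derive; [exact Logic.I | field; lra].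
- intros t _. apply (ex_derive_continuous (V := R_NormedModule)). auto_derive.
  exact Logic.I.
Qed.

(** Uniform convergence replaces dominated convergence twice: once in t on each [0, b], then in b,
    because the exponential factor bounds the k-th integral over [0, b] by [A k / al] for every
    b. *)
Lemma is_RInt_gen_series {V : CompleteNormedModule R_AbsRing} 
    (g : nat -> R -> V) (G : R -> V) (l : nat -> V)
    (A : nat -> R) (al : R) :
  0 < al ->
  (forall k t, 0 <= t -> norm (g k t) <= A k * exp (- al * t)) ->
  ex_series A ->
  (forall t, 0 <= t -> is_series (fun k => g k t) (G t)) ->
  (forall k, is_RInt_gen (g k) (at_point 0) (Rbar_locally p_infty) (l k)) ->
  exists L, is_series l L /\
    is_RInt_gen G (at_point 0) (Rbar_locally p_infty) L.
Proof.
intros Hal Hg HA HG Hl.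
assert (HA0 : forall k, 0 <= A k).
{ intros k. specialize (Hg k 0 (Rle_refl 0)).
  rewrite Rmult_0_r, exp_0, Rmult_1_r in Hg.
  eapply Rle_trans; [apply (norm_ge_0 (V := V)) | exact Hg]. }
assert (He : forall b, 0 <= b -> exp (- al * b) <= 1).
{ intros b Hb. rewrite <- exp_0. destruct Hb as [Hb | <-].
  - left. apply exp_increasing. nra.
  - rewrite Rmult_0_r. apply Rle_refl. }
(* The exchange of limits needs bounds uniform over all real b; [Rmax 0 b] keeps the upper endpoint
   nonnegative. *)
set (h k b := RInt (g k) 0 (Rmax 0 b)).
assert (Hh : forall k b, 0 <= b -> is_RInt (g k) 0 b (h k b)).
{ intros k b Hb. unfold h. rewrite Rmax_right by exact Hb.
  destruct (proj1 (is_RInt_gen_p_infty_iff _ _ _) (Hl k)) as [I [HI _]].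
  apply (RInt_correct (g k)). exists (I b). apply HI, Hb. }
assert (Hhl : forall k, filterlim (h k) (Rbar_locally p_infty) (locally (l k))).
{ intros k.
  destruct (proj1 (is_RInt_gen_p_infty_iff _ _ _) (Hl k)) as [I [HI HIl]].
  apply filterlim_ext_loc with I; [| exact HIl].
  exists 0. intros b Hb. symmetry. unfold h. rewrite Rmax_right by lra.
  apply is_RInt_unique, HI. lra. }
assert (Hbd : forall k b, norm (h k b) <= A k / al).
{ intros k b.
  assert (Hb : 0 <= Rmax 0 b) by apply Rmax_l.
  replace (h k b) with (h k (Rmax 0 b))
    by (unfold h; rewrite (Rmax_right 0 (Rmax 0 b)) by exact Hb; reflexivity).
  apply Rle_trans with (A k * (1 - exp (- al * Rmax 0 b)) / al)%R.
  - apply (norm_RInt_le (g k) (fun t => A k * exp (- al * t))%R 0 (Rmax 0 b)).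
    + exact Hb.
    + intros t Ht. apply Hg. lra.
    + apply Hh, Hb.
    + apply is_RInt_exp_neg, Hal.
  - unfold Rdiv. apply Rmult_le_compat_r.
    + left. apply Rinv_0_lt_compat, Hal.
    + generalize (HA0 k) (exp_pos (- al * Rmax 0 b)). nra. }
assert (HAal : ex_series (fun k => A k / al)%R).
{ destruct HA as [B HB]. exists (B * / al)%R. apply (is_series_scal_r (/ al) A B HB). }
assert (HI : forall b, 0 <= b -> exists I, is_series (fun k => h k b) I /\ is_RInt G 0 b I).
{ intros b Hb. apply (is_RInt_series g G _ A).
  - exact Hb.
  - intros k t Ht. eapply Rle_trans; [apply Hg; lra |].
    generalize (HA0 k) (He t (proj1 Ht)). nra.
  - exact HA.
  - intros t Ht. apply HG. lra.
  - intros k. apply Hh, Hb. }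
assert (HI' : forall b, is_series (fun k => h k b) (RInt G 0 (Rmax 0 b))).
{ intros b. destruct (HI (Rmax 0 b) (Rmax_l 0 b)) as [I [H1 H2]].
  rewrite (is_RInt_unique _ _ _ _ H2).
  apply is_series_ext with (2 := H1). intros k. unfold h.
  rewrite (Rmax_right 0 (Rmax 0 b)) by apply Rmax_l. reflexivity. }
destruct (filterlim_switch (U := V) eventually _ (Rbar_locally p_infty) _
            (fun N b => sum_n (fun k => h k b) N)
            (fun b => RInt G 0 (Rmax 0 b)) (fun N => sum_n l N))
  as [L [HL1 HL2]].
- apply (sum_n_uniform_limit h (fun k => A k / al)%R); assumption.
- intros N. induction N as [|N IH].
  + apply filterlim_ext with (h 0%nat); [| rewrite sum_O; apply Hhl].
    intros b. rewrite sum_O. reflexivity.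
  + rewrite sum_Sn.
    apply filterlim_ext with (fun b => plus (sum_n (fun k => h k b) N) (h (S N) b)).
    * intros b. rewrite sum_Sn. reflexivity.
    * eapply filterlim_comp_2; [exact IH | apply Hhl | apply (filterlim_plus (V := V))].
- exists L. split; [exact HL1 |].
  apply is_RInt_gen_p_infty_iff. exists (fun b => RInt G 0 (Rmax 0 b)).
  split; [| exact HL2].
  intros b Hb. rewrite Rmax_right by exact Hb.
  apply (RInt_correct G). destruct (HI b Hb) as [I [_ H2]]. exists I. exact H2.
Qed.

(** * Linear images of series and integrals *)

(* [ring] does not recognise an equation typed in a module structure on [C]. *)
Ltac Cring := match goal with |- ?a = ?b => change (a = b :> C); ring end.

Lemma norm_C_R (u : C) : @norm R_AbsRing C_R_NormedModule u = Cmod u.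
Proof.
destruct u as [a b]. unfold norm; simpl. unfold prod_norm, Cmod, norm; simpl.
unfold abs; simpl. f_equal.
rewrite !Rmult_1_r, <- !Rabs_mult, !Rabs_pos_eq by nra. reflexivity.
Qed.

Lemma is_linear_Cmult_l (c : C) :
  is_linear (U := C_R_NormedModule) (V := C_R_NormedModule) (fun u => (c * u)%C).
Proof.
split.
- intros u v. change (c * (u + v) = c * u + c * v)%C. ring.
- intros k u. apply injective_projections; simpl;
    unfold scal; simpl; unfold mult; simpl; ring.
- exists (Cmod c + 1)%R. split.
  + generalize (Cmod_ge_0 c). lra.
  + intros u. rewrite !norm_C_R, Cmod_mult.
    generalize (Cmod_ge_0 c) (Cmod_ge_0 u). nra.
Qed.

Lemma is_linear_RtoC : is_linear (V := C_R_NormedModule) RtoC.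
Proof.
split.
- intros u v. apply injective_projections; simpl; unfold plus; simpl; ring.
- intros k u. apply injective_projections; simpl;
    unfold scal; simpl; unfold mult; simpl; ring.
- exists 1. split; [lra |]. intros u. rewrite norm_C_R, Cmod_R, Rmult_1_l.
  apply Rle_refl.
Qed.

Lemma is_series_linear {U V : NormedModule R_AbsRing} (phi : U -> V)
    (a : nat -> U) (l : U) :
  is_linear phi ->
  is_series a l -> is_series (fun k => phi (a k)) (phi l).
Proof.
intros Hphi Ha.
apply filterlim_ext with (fun N => phi (sum_n a N)).
- intros N. induction N as [|N IH].
  + rewrite !sum_O. reflexivity.
  + rewrite !sum_Sn, <- IH. apply (linear_plus phi Hphi).
- eapply filterlim_comp; [exact Ha |]. apply linear_cont, Hphi.
Qed.

(** A continuous linear map commutes with Riemann sums and with their limit. This gives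
    multiplication by a complex constant, which is only a real-linear map for the module in which
    the integral lives. *)
Lemma is_RInt_linear {U V : NormedModule R_AbsRing} (phi : U -> V)
    (f : R -> U) (a b : R) (l : U) :
  is_linear phi ->
  is_RInt f a b l -> is_RInt (fun t => phi (f t)) a b (phi l).
Proof.
intros Hphi Hf. unfold is_RInt.
apply filterlim_ext with
  (fun ptd => phi (scal (sign (b - a)) (Riemann_sum f ptd))).
- intros ptd. rewrite (linear_scal phi Hphi). f_equal.
  induction ptd as [x0 | h ptd IH] using SF_cons_ind.
  + apply (linear_zero phi Hphi).
  + rewrite !Riemann_sum_cons, (linear_plus phi Hphi), (linear_scal phi Hphi), IH.
    reflexivity.
- eapply filterlim_comp; [exact Hf |]. apply linear_cont, Hphi.
Qed.

Lemma is_RInt_gen_linear {U V : NormedModule R_AbsRing} (phi : U -> V)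
    (f : R -> U) (Fa Fb : (R -> Prop) -> Prop) (l : U) :
  is_linear phi ->
  Filter Fa -> Filter Fb ->
  is_RInt_gen f Fa Fb l -> is_RInt_gen (fun t => phi (f t)) Fa Fb (phi l).
Proof.
intros Hphi Ha Hb Hf P HP.
assert (HQ : locally l (fun u => P (phi u))) by (apply (linear_cont phi l Hphi), HP).
generalize (Hf _ HQ). unfold filtermapi. apply filter_imp.
intros [x y] [u [Hu Pu]]. exists (phi u). split; [| exact Pu].
apply (is_RInt_linear phi), Hu. exact Hphi.
Qed.

Lemma is_series_Re (a : nat -> C) (l : C) :
  is_series (V := C_R_NormedModule) a l -> is_series (fun k => Re (a k)) (Re l).
Proof.
apply (is_series_linear (U := C_R_NormedModule) (V := R_NormedModule) (fst : C -> R)).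
apply (is_linear_fst (U := R_NormedModule) (V := R_NormedModule)).
Qed.

Lemma is_series_Im (a : nat -> C) (l : C) :
  is_series (V := C_R_NormedModule) a l -> is_series (fun k => Im (a k)) (Im l).
Proof.
apply (is_series_linear (U := C_R_NormedModule) (V := R_NormedModule) (snd : C -> R)).
apply (is_linear_snd (U := R_NormedModule) (V := R_NormedModule)).
Qed.

Lemma CSeries_unique (a : nat -> C) (l : C) :
  is_series (V := C_R_NormedModule) a l -> CSeries a = l.
Proof.
intros Ha. apply injective_projections; simpl; apply is_series_unique.
- apply is_series_Re, Ha.
- apply is_series_Im, Ha.
Qed.

(** * Rules for the Laplace transform and decay of exponential monomials *)

Lemma is_Laplace_Cmult_l (f : R -> C) (s l c : C) :
  is_Laplace f s l -> is_Laplace (fun t => c * f t)%C s (c * l)%C.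
Proof.
unfold is_Laplace. intros Hf.
apply (is_RInt_gen_ext (V := C_R_NormedModule)
         (fun t => c * (Cexp (- (s * RtoC t)) * f t))%C).
- apply filter_forall. intros ab t _. Cring.
- apply (is_RInt_gen_linear (U := C_R_NormedModule) (V := C_R_NormedModule)
           (fun u => c * u)%C); try exact _; [apply is_linear_Cmult_l | exact Hf].
Qed.

Lemma is_Laplace_plus (f g : R -> C) (s l m : C) :
  is_Laplace f s l -> is_Laplace g s m ->
  is_Laplace (fun t => f t + g t)%C s (l + m)%C.
Proof.
unfold is_Laplace. intros Hf Hg.
apply (is_RInt_gen_ext (V := C_R_NormedModule)
  (fun t => Cexp (- (s * RtoC t)) * f t + Cexp (- (s * RtoC t)) * g t)%C).
- apply filter_forall. intros ab t _. Cring.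
- apply (is_RInt_gen_plus (V := C_R_NormedModule) _ _ _ _ Hf Hg).
Qed.

Lemma is_Laplace_ext (f g : R -> C) (s l : C) :
  (forall t, 0 <= t -> f t = g t) -> is_Laplace f s l -> is_Laplace g s l.
Proof.
unfold is_Laplace. intros Hfg. apply (is_RInt_gen_ext (V := C_R_NormedModule)).
exists (fun x => x = 0) (fun b => 0 < b).
- reflexivity.
- exists 0. intros b Hb. exact Hb.
- intros x b -> Hb t Ht. simpl in Ht. rewrite Rmin_left in Ht by lra.
  rewrite Hfg by lra. reflexivity.
Qed.

Lemma Cmod_Cexp (u : C) : Cmod (Cexp u) = exp (Re u).
Proof.
unfold Cmod, Cexp; simpl fst; simpl snd.
replace ((exp (Re u) * cos (Im u)) ^ 2 + (exp (Re u) * sin (Im u)) ^ 2)%R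
  with (exp (Re u) ^ 2)%R.
- apply sqrt_pow2. left. apply exp_pos.
- generalize (sin2_cos2 (Im u)). unfold Rsqr. intros E.
  rewrite <- (Rmult_1_r (exp (Re u) ^ 2)), <- E. ring.
Qed.

(** One term of the exponential series is at most its sum. Both the decay of e^{-st} t^m and the
    Bessel bounds rest on this estimate. *)
Lemma pow_div_fact_le_exp (x : R) (m : nat) : 0 <= x -> x ^ m / INR (fact m) <= exp x.
Proof.
intros Hx. eapply Rle_trans; [| apply (exp_ge_taylor x m Hx)].
destruct m as [|m]; [apply Rle_refl |].
rewrite tech5. rewrite <- (Rplus_0_l (x ^ S m / _)) at 1.
apply Rplus_le_compat_r. apply cond_pos_sum. intros k.
apply Rmult_le_pos; [apply pow_le, Hx |].
left. apply Rinv_0_lt_compat, INR_fact_lt_0.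
Qed.

(** The normalisation by m! makes differentiation free of coefficients: writing E_m for this
    function, E_{m+1}' = E_m - s E_{m+1}. *)
Definition exp_monomial (s : C) (m : nat) (t : R) : C :=
  (Cexp (- (s * RtoC t)) * RtoC (t ^ m / INR (fact m)))%C.

(** Half of the decay absorbs the monomial: with a = Re s, (a b / 2)^m / m! <= e^{ab/2}, which
    leaves (2/a)^m e^{-ab/2}. *)
Lemma exp_monomial_lim (s : C) (m : nat) : 0 < Re s ->
  filterlim (exp_monomial s m) (Rbar_locally p_infty)
    (locally (RtoC 0 : C_R_NormedModule)).
Proof.
intros Hs. set (a := Re s).
assert (L : is_lim (fun b => (2 / a) ^ m * exp (- (a / 2) * b))%R p_infty 0).
{ replace (Finite 0) with (Rbar_mult (Finite ((2 / a) ^ m)) 0)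
    by (simpl; f_equal; ring).
  apply is_lim_scal_l.
  apply (is_lim_comp exp (fun b => - (a / 2) * b)%R p_infty 0 m_infty).
  - apply is_lim_exp_m.
  - replace m_infty with (Rbar_mult (Finite (- (a / 2))) p_infty).
    + apply is_lim_scal_l, is_lim_id.
    + unfold a. simpl. destruct (Rle_dec 0 (- (Re s / 2))); [exfalso; lra | reflexivity].
  - exists 0. intros b _. discriminate. }
apply filterlim_locally. intros eps.
generalize (proj1 (filterlim_locally _ _) L eps). intros [M HM].
exists (Rmax 0 M). intros b Hb.
assert (Hb0 : 0 < b) by (generalize (Rmax_l 0 M); lra).
assert (HbM : M < b) by (generalize (Rmax_r 0 M); lra).
specialize (HM b HbM).
change (Rabs ((2 / a) ^ m * exp (- (a / 2) * b) - 0) < eps)%R in HM.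
rewrite Rminus_0_r in HM. apply Rle_lt_trans with (1 := Rle_abs _) in HM.
apply (norm_compat1 (V := C_R_NormedModule)).
rewrite norm_C_R. eapply Rle_lt_trans; [| exact HM].
change (Cmod (exp_monomial s m b - 0)%C <= (2 / a) ^ m * exp (- (a / 2) * b)).
unfold Cminus. rewrite Copp_0, Cplus_0_r. unfold exp_monomial.
rewrite Cmod_mult, Cmod_Cexp, Cmod_R.
replace (Re (- (s * RtoC b))) with (- (a * b))%R by (unfold a, Re; simpl; ring).
assert (Hp : 0 < b ^ m / INR (fact m)).
{ apply Rdiv_lt_0_compat; [apply pow_lt, Hb0 | apply INR_fact_lt_0]. }
rewrite Rabs_pos_eq by lra.
replace (b ^ m / INR (fact m))%R
  with ((2 / a) ^ m * ((a / 2 * b) ^ m / INR (fact m)))%R.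
2:{ rewrite !Rpow_mult_distr. unfold Rdiv. rewrite !Rmult_assoc, <- !Rmult_assoc.
    rewrite <- !Rpow_mult_distr.
    replace (2 * / a * (a * / 2) * b)%R with b; [reflexivity | field; unfold a; lra]. }
replace (- (a * b))%R with (- (a / 2) * b + - (a / 2 * b))%R by field.
rewrite exp_plus.
assert (H1 := pow_div_fact_le_exp (a / 2 * b) m).
assert (H2 : 0 <= a / 2 * b) by (apply Rmult_le_pos; unfold a; lra).
specialize (H1 H2).
assert (H3 : exp (- (a / 2 * b)) * exp (a / 2 * b) = 1)
  by (rewrite <- exp_plus, Rplus_opp_l; apply exp_0).
assert (H4 := exp_pos (- (a / 2 * b))). assert (H5 := exp_pos (- (a / 2) * b)).
assert (H6 : 0 < (2 / a) ^ m) by (apply pow_lt, Rdiv_lt_0_compat; [lra | exact Hs]).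
set (E1 := exp (- (a / 2) * b)) in *. set (E2 := exp (- (a / 2 * b))) in *.
set (E3 := exp (a / 2 * b)) in *. set (y := ((a / 2 * b) ^ m / INR (fact m))%R) in *.
replace (E1 * E2 * ((2 / a) ^ m * y))%R with ((2 / a) ^ m * E1 * (E2 * y))%R by ring.
rewrite <- (Rmult_1_r ((2 / a) ^ m * E1)) at 2.
apply Rmult_le_compat_l; [nra |]. rewrite <- H3. apply Rmult_le_compat_l; lra.
Qed.

(** * Laplace transforms of monomials *)

Lemma is_RInt_C_derive (F dF : R -> C) (a b : R) :
  (forall t, is_derive (fun t => Re (F t)) t (Re (dF t))) ->
  (forall t, is_derive (fun t => Im (F t)) t (Im (dF t))) ->
  (forall t, ex_derive (fun t => Re (dF t)) t) ->
  (forall t, ex_derive (fun t => Im (dF t)) t) ->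
  is_RInt (V := C_R_NormedModule) dF a b (F b - F a)%C.
Proof.
intros HRe HIm CRe CIm.
apply (is_RInt_fct_extend_pair (U := R_NormedModule) (V := R_NormedModule)).
- apply (is_RInt_derive (V := R_CompleteNormedModule) (fun t => Re (F t)) (fun t => Re (dF t))).
  + intros t _. apply HRe.
  + intros t _. apply (ex_derive_continuous (V := R_NormedModule)), CRe.
- apply (is_RInt_derive (V := R_CompleteNormedModule) (fun t => Im (F t)) (fun t => Im (dF t))).
  + intros t _. apply HIm.
  + intros t _. apply (ex_derive_continuous (V := R_NormedModule)), CIm.
Qed.

Lemma is_RInt_gen_C_derive (F dF : R -> C) (l : C) :
  (forall t, is_derive (fun t => Re (F t)) t (Re (dF t))) ->
  (forall t, is_derive (fun t => Im (F t)) t (Im (dF t))) ->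
  (forall t, ex_derive (fun t => Re (dF t)) t) ->
  (forall t, ex_derive (fun t => Im (dF t)) t) ->
  filterlim F (Rbar_locally p_infty) (locally (l : C_R_NormedModule)) ->
  is_RInt_gen (V := C_R_NormedModule) dF (at_point 0) (Rbar_locally p_infty)
    (l - F 0)%C.
Proof.
intros HRe HIm CRe CIm Hl.
apply (is_RInt_gen_p_infty_iff (V := C_R_CompleteNormedModule)).
exists (fun b => F b - F 0)%C. split.
- intros b _. apply is_RInt_C_derive; assumption.
- apply (filterlim_comp_2 (H := locally (- F 0 : C_R_NormedModule)%C) F
           (fun _ => - F 0)%C Cplus Hl).
  + apply filterlim_const.
  + apply (filterlim_plus (V := C_R_NormedModule)).
Qed.

Lemma exp_monomial_eq (s : C) (m : nat) (t : R) :
  exp_monomial s m t =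
  (exp (- (Re s * t)) * cos (Im s * t) * (t ^ m / INR (fact m)),
   - (exp (- (Re s * t)) * sin (Im s * t) * (t ^ m / INR (fact m))))%R.
Proof.
unfold exp_monomial, Cexp.
replace (Re (- (s * RtoC t))) with (- (Re s * t))%R by (unfold Re; simpl; ring).
replace (Im (- (s * RtoC t))) with (- (Im s * t))%R by (unfold Im; simpl; ring).
rewrite cos_neg, sin_neg. apply injective_projections; simpl; ring.
Qed.

(** Integrating E_{m+1}' = E_m - s E_{m+1}, whose boundary values vanish at 0 and at infinity,
    divides the transform by s at each step. The induction starts from E_0' = - s E_0 with E_0 (0) =
    1. *)
Lemma is_Laplace_monomial (s : C) (m : nat) : 0 < Re s ->
  is_Laplace (fun t => RtoC (t ^ m / INR (fact m))) s (/ s ^ S m)%C.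
Proof.
intros Hs.
assert (Hs0 : s <> 0%C) by (intros E; rewrite E in Hs; simpl in Hs; lra).
assert (Hre : forall k t, Re (exp_monomial s k t) =
   (exp (- (Re s * t)) * cos (Im s * t) * (t ^ k / INR (fact k)))%R)
  by (intros; rewrite exp_monomial_eq; reflexivity).
assert (Him : forall k t, Im (exp_monomial s k t) =
   (- (exp (- (Re s * t)) * sin (Im s * t) * (t ^ k / INR (fact k))))%R)
  by (intros; rewrite exp_monomial_eq; reflexivity).
assert (HsE : forall k t, Re (s * exp_monomial s k t)%C =
   (Re s * Re (exp_monomial s k t) - Im s * Im (exp_monomial s k t))%R)
  by (intros; reflexivity).
assert (HsE' : forall k t, Im (s * exp_monomial s k t)%C =
   (Re s * Im (exp_monomial s k t) + Im s * Re (exp_monomial s k t))%R)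
  by (intros; reflexivity).
unfold is_Laplace.
change (is_RInt_gen (V := C_R_NormedModule) (exp_monomial s m) (at_point 0)
          (Rbar_locally p_infty) (/ s ^ S m)%C).
induction m as [|m IH].
- assert (H : is_RInt_gen (V := C_R_NormedModule) (fun t => - (s * exp_monomial s 0 t))%C
            (at_point 0) (Rbar_locally p_infty) (0 - exp_monomial s 0 0)%C).
  { apply is_RInt_gen_C_derive.
    5: apply exp_monomial_lim, Hs.
    - intros t. apply is_derive_ext with (1 := fun u => eq_sym (Hre 0%nat u)).
      change (Re (- (s * exp_monomial s 0 t))) with (- Re (s * exp_monomial s 0 t)).
      rewrite HsE, Hre, Him. auto_derive; [exact Logic.I | simpl; field].
    - intros t. apply is_derive_ext with (1 := fun u => eq_sym (Him 0%nat u)).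
      change (Im (- (s * exp_monomial s 0 t))) with (- Im (s * exp_monomial s 0 t)).
      rewrite HsE', Hre, Him. auto_derive; [exact Logic.I | simpl; field].
    - intros t. apply ex_derive_ext with (fun t =>
        (- (Re s * (exp (- (Re s * t)) * cos (Im s * t) * (t ^ 0 / INR (fact 0))) -
         Im s * (- (exp (- (Re s * t)) * sin (Im s * t) * (t ^ 0 / INR (fact 0))))))%R).
      + intros u. rewrite <- Hre, <- Him. reflexivity.
      + auto_derive. exact Logic.I.
    - intros t. apply ex_derive_ext with (fun t =>
        (- (Re s * (- (exp (- (Re s * t)) * sin (Im s * t) * (t ^ 0 / INR (fact 0)))) +
         Im s * (exp (- (Re s * t)) * cos (Im s * t) * (t ^ 0 / INR (fact 0)))))%R).
      + intros u. rewrite <- Hre, <- Him. reflexivity.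
      + auto_derive. exact Logic.I. }
  apply (is_RInt_gen_linear _ _ _ _ _ (is_linear_Cmult_l (- / s)%C) _ _) in H.
  replace (/ s ^ 1)%C with (- / s * (0 - exp_monomial s 0 0))%C.
  2:{ rewrite exp_monomial_eq, !Rmult_0_r, Ropp_0, exp_0, cos_0, sin_0. simpl.
      replace ((1 * 1 * (1 / 1), - (1 * 0 * (1 / 1)))%R : C) with (RtoC 1)
        by (apply injective_projections; simpl; field).
      field. exact Hs0. }
  revert H. apply (is_RInt_gen_ext (V := C_R_NormedModule)).
  apply filter_forall. intros ab t _.
  match goal with |- ?a = ?b => change (a = b :> C) end. field. exact Hs0.
- assert (H : is_RInt_gen (V := C_R_NormedModule)
            (fun t => exp_monomial s m t - s * exp_monomial s (S m) t)%C
            (at_point 0) (Rbar_locally p_infty) (0 - exp_monomial s (S m) 0)%C).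
  { assert (Hm := INR_fact_neq_0 m).
    assert (Hm' : INR (S m) <> 0) by apply not_0_INR, Nat.neq_succ_0.
    apply is_RInt_gen_C_derive.
    5: apply exp_monomial_lim, Hs.
    - intros t. apply is_derive_ext with (1 := fun u => eq_sym (Hre (S m) u)).
      change (Re (exp_monomial s m t - (s * exp_monomial s (S m) t)))
        with (Re (exp_monomial s m t) + - Re (s * exp_monomial s (S m) t)).
      rewrite HsE, !Hre, Him, fact_simpl, mult_INR.
      auto_derive; [exact Logic.I |].
      change (match m with 0%nat => 1 | S _ => INR m + 1 end)%R with (INR (S m)).
      change (t ^ S m) with (t * t ^ m).
      field. split; assumption.
    - intros t. apply is_derive_ext with (1 := fun u => eq_sym (Him (S m) u)).
      change (Im (exp_monomial s m t - (s * exp_monomial s (S m) t)))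
        with (Im (exp_monomial s m t) + - Im (s * exp_monomial s (S m) t)).
      rewrite HsE', !Him, Hre, fact_simpl, mult_INR.
      auto_derive; [exact Logic.I |].
      change (match m with 0%nat => 1 | S _ => INR m + 1 end)%R with (INR (S m)).
      change (t ^ S m) with (t * t ^ m).
      field. split; assumption.
    - intros t. apply ex_derive_ext with (fun t =>
        (exp (- (Re s * t)) * cos (Im s * t) * (t ^ m / INR (fact m)) +
         - (Re s * (exp (- (Re s * t)) * cos (Im s * t) * (t ^ S m / INR (fact (S m)))) -
         Im s * (- (exp (- (Re s * t)) * sin (Im s * t) * (t ^ S m / INR (fact (S m)))))))%R).
      + intros u. rewrite <- !Hre, <- Him. reflexivity.
      + auto_derive. exact Logic.I.
    - intros t. apply ex_derive_ext with (fun t =>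
        (- (exp (- (Re s * t)) * sin (Im s * t) * (t ^ m / INR (fact m))) +
         - (Re s * (- (exp (- (Re s * t)) * sin (Im s * t) * (t ^ S m / INR (fact (S m))))) +
         Im s * (exp (- (Re s * t)) * cos (Im s * t) * (t ^ S m / INR (fact (S m))))))%R).
      + intros u. rewrite <- Hre, <- !Him. reflexivity.
      + auto_derive. exact Logic.I. }
  assert (H2 := is_RInt_gen_minus (V := C_R_NormedModule) _ _ _ _ IH H).
  apply (is_RInt_gen_linear _ _ _ _ _ (is_linear_Cmult_l (/ s)%C) _ _) in H2.
  replace (/ s ^ S (S m))%C with (/ s * (/ s ^ S m - (0 - exp_monomial s (S m) 0)))%C.
  2:{ rewrite exp_monomial_eq, Rmult_0_r. rewrite pow_i by lia.
      replace ((exp (- 0) * cos (Im s * 0) * (0 / INR (fact (S m))),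
                - (exp (- 0) * sin (Im s * 0) * (0 / INR (fact (S m)))))%R : C) with (RtoC 0)
        by (apply injective_projections; simpl; unfold Rdiv; ring).
      simpl. field. split; [apply Cpow_nz |]; exact Hs0. }
  revert H2. apply (is_RInt_gen_ext (V := C_R_NormedModule)).
  apply filter_forall. intros ab t _.
  change (/ s * (exp_monomial s m t -
                 (exp_monomial s m t - s * exp_monomial s (S m) t))
          = exp_monomial s (S m) t)%C.
  field. exact Hs0.
Qed.

(** * Bessel functions *)

(** The gap [Re s - sigma] becomes the decay rate of the dominating exponentials. That the
    transforms themselves form a convergent series is kept in the conclusion, since it later yields
    L_k -> 0. *)
Lemma is_Laplace_series (f : nat -> R -> C) (l : nat -> C) (A : nat -> R)
    (sigma : R) (s : C) :
  sigma < Re s ->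
  (forall k t, 0 <= t -> Cmod (f k t) <= A k * exp (sigma * t)) ->
  ex_series A ->
  (forall k, is_Laplace (f k) s (l k)) ->
  exists L, is_series (V := C_R_NormedModule) l L /\
    is_Laplace (fun t => CSeries (fun k => f k t)) s L.
Proof.
intros Hs Hf HA Hl.
assert (Hsum : forall t, 0 <= t ->
          is_series (V := C_R_NormedModule) (fun k => f k t) (CSeries (fun k => f k t))).
{ intros t Ht.
  destruct (ex_series_le (V := C_R_CompleteNormedModule) (fun k => f k t)
              (fun k => A k * exp (sigma * t))%R) as [S HS].
  - intros k. change (@norm R_AbsRing C_R_NormedModule (f k t) <= A k * exp (sigma * t)).
    rewrite norm_C_R. apply Hf, Ht.
  - destruct HA as [B HB]. eexists. apply is_series_scal_r, HB.
  - rewrite (CSeries_unique _ _ HS). exact HS. }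
apply (is_RInt_gen_series (V := C_R_CompleteNormedModule)
         (fun k t => Cexp (- (s * RtoC t)) * f k t)%C _ l A (Re s - sigma)%R).
- lra.
- intros k t Ht.
  change (@norm R_AbsRing C_R_NormedModule (Cexp (- (s * RtoC t)) * f k t)%C <=
          A k * exp (- (Re s - sigma) * t)).
  rewrite norm_C_R, Cmod_mult, Cmod_Cexp.
  replace (Re (- (s * RtoC t))) with (- (Re s * t))%R by (unfold Re; simpl; ring).
  replace (- (Re s - sigma) * t)%R with (- (Re s * t) + sigma * t)%R by ring.
  rewrite exp_plus, (Rmult_comm (A k)), Rmult_assoc, (Rmult_comm _ (A k)).
  apply Rmult_le_compat_l; [left; apply exp_pos | apply Hf, Ht].
- exact HA.
- intros t Ht.
  apply (is_series_linear (U := C_R_NormedModule) (V := C_R_NormedModule)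
           (fun u => Cexp (- (s * RtoC t)) * u)%C (fun k => f k t)).
  + apply is_linear_Cmult_l.
  + apply Hsum, Ht.
- exact Hl.
Qed.

Definition bessel_term (k p : nat) (u : R) : R :=
  ((-1) ^ p / (INR (fact p) * INR (fact (p + k))) * (u / 2) ^ (2 * p + k))%R.

(** Splitting u^{2p+k} as u^p u^{p+k} pairs each power with one factorial, and each quotient is at
    most e^u; the powers of 1/2 remain as 2^{-k} 4^{-p}. The rate 2 in the exponential is the origin
    of the condition Re s > 2 z. *)
Lemma bessel_term_bound (k p : nat) (u : R) : 0 <= u ->
  Rabs (bessel_term k p u) <= (1 / 2) ^ k * (1 / 4) ^ p * exp (2 * u).
Proof.
intros Hu. unfold bessel_term.
assert (H1 := pow_div_fact_le_exp u p Hu).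
assert (H2 := pow_div_fact_le_exp u (p + k) Hu).
assert (P1 := INR_fact_lt_0 p). assert (P2 := INR_fact_lt_0 (p + k)).
assert (Q1 : 0 <= u ^ p / INR (fact p)).
{ apply Rmult_le_pos; [apply pow_le, Hu | left; apply Rinv_0_lt_compat, P1]. }
assert (Q2 : 0 <= u ^ (p + k) / INR (fact (p + k))).
{ apply Rmult_le_pos; [apply pow_le, Hu | left; apply Rinv_0_lt_compat, P2]. }
replace ((-1) ^ p / (INR (fact p) * INR (fact (p + k))) * (u / 2) ^ (2 * p + k))%R
  with ((-1) ^ p * ((1 / 2) ^ k * (1 / 4) ^ p *
         (u ^ p / INR (fact p) * (u ^ (p + k) / INR (fact (p + k))))))%R.
2:{ replace (1 / 4)%R with (1 / 2 * (1 / 2))%R by field.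
    replace (u / 2)%R with (u * (1 / 2))%R by field.
    replace (2 * p + k)%nat with (p + (p + k))%nat by lia.
    rewrite !Rpow_mult_distr, !pow_add. field. split; lra. }
rewrite Rabs_mult, pow_1_abs, Rmult_1_l, Rabs_pos_eq.
- apply Rmult_le_compat_l.
  + apply Rmult_le_pos; apply pow_le; lra.
  + replace (2 * u)%R with (u + u)%R by ring. rewrite exp_plus.
    apply Rmult_le_compat; assumption.
- apply Rmult_le_pos; apply Rmult_le_pos; try assumption; apply pow_le; lra.
Qed.

Lemma is_series_bessel_bound (k : nat) :
  is_series (fun p => (1 / 2) ^ k * (1 / 4) ^ p)%R ((1 / 2) ^ k * (4 / 3))%R.
Proof.
apply (is_series_scal_l (V := R_NormedModule) ((1 / 2) ^ k)%R (fun p => (1 / 4) ^ p)%R).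
replace (4 / 3)%R with (/ (1 - 1 / 4))%R by field.
apply is_series_geom. rewrite Rabs_pos_eq; lra.
Qed.

Lemma is_series_BesselJ (k : nat) (u : R) : 0 <= u ->
  is_series (fun p => bessel_term k p u) (BesselJ k u).
Proof.
intros Hu. apply (Series_correct (fun p => bessel_term k p u)).
apply (ex_series_le (V := R_CompleteNormedModule) _
         (fun p => (1 / 2) ^ k * (1 / 4) ^ p * exp (2 * u))%R).
- intros p. apply bessel_term_bound, Hu.
- eexists. apply is_series_scal_r, is_series_bessel_bound.
Qed.

(** The constant 4/3 is the sum of the 4^{-p}. *)
Lemma BesselJ_bound (k : nat) (u : R) : 0 <= u ->
  Rabs (BesselJ k u) <= 4 / 3 * (1 / 2) ^ k * exp (2 * u).
Proof.
intros Hu.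
apply (norm_series_le (V := R_NormedModule) (fun p => bessel_term k p u) _
         (fun p => (1 / 2) ^ k * (1 / 4) ^ p * exp (2 * u))%R).
- intros p. apply bessel_term_bound, Hu.
- apply is_series_BesselJ, Hu.
- rewrite (Rmult_comm (4 / 3)). apply is_series_scal_r, is_series_bessel_bound.
Qed.

(** * Laplace transforms of the Bessel functions and their recurrences *)

(** The coefficient of t^{2p+k} / (2p+k)! in J_k(z t), that is (-1)^p binom(2p+k, p)
    (z/2)^{2p+k}. *)
Definition bessel_coef (z : R) (k p : nat) : R :=
  ((-1) ^ p * INR (fact (2 * p + k)) / (INR (fact p) * INR (fact (p + k)))
   * (z / 2) ^ (2 * p + k))%R.

Definition bessel_laplace_term (z : R) (s : C) (k p : nat) : C :=
  (RtoC (bessel_coef z k p) * / s ^ S (2 * p + k))%C.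

Definition bessel_laplace (z : R) (s : C) (k : nat) : C :=
  CSeries (bessel_laplace_term z s k).

Lemma is_Laplace_BesselJ_series (z : R) (s : C) (k : nat) :
  0 < z -> 2 * z < Re s ->
  is_series (V := C_R_NormedModule) (bessel_laplace_term z s k) (bessel_laplace z s k) /\
  is_Laplace (fun t => RtoC (BesselJ k (z * t))) s (bessel_laplace z s k).
Proof.
intros Hz Hs.
destruct (is_Laplace_series (fun p t => RtoC (bessel_term k p (z * t)))
            (bessel_laplace_term z s k) (fun p => (1 / 2) ^ k * (1 / 4) ^ p)%R
            (2 * z)%R s Hs) as [L [H1 H2]].
- intros p t Ht. rewrite Cmod_R, (Rmult_assoc 2). apply bessel_term_bound. nra.
- eexists. apply is_series_bessel_bound.
- intros p. apply is_Laplace_ext with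
    (fun t => RtoC (bessel_coef z k p) * RtoC (t ^ (2 * p + k) / INR (fact (2 * p + k))))%C.
  + intros t _. rewrite <- RtoC_mult. f_equal. unfold bessel_term, bessel_coef.
    replace (z * t / 2)%R with (z / 2 * t)%R by field. rewrite Rpow_mult_distr.
    field. repeat split; apply INR_fact_neq_0.
  + apply is_Laplace_Cmult_l, is_Laplace_monomial. lra.
- unfold bessel_laplace. rewrite (CSeries_unique _ _ H1). split; [exact H1 |].
  revert H2. apply is_Laplace_ext. intros t Ht. apply CSeries_unique.
  apply (is_series_linear (U := R_NormedModule) (V := C_R_NormedModule) RtoC
           (fun p => bessel_term k p (z * t)) (BesselJ k (z * t)) is_linear_RtoC).
  apply is_series_BesselJ. nra.
Qed.

Lemma bessel_coef_0 (z : R) (k : nat) : bessel_coef z k 0 = ((z / 2) ^ k)%R.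
Proof.
unfold bessel_coef. simpl (2 * 0 + k)%nat. simpl (0 + k)%nat.
simpl (fact 0). simpl INR at 2. field. apply INR_fact_neq_0.
Qed.

(** With N = 2p+k+2 this is binom(N+1, p+1) = binom(N, p+1) + binom(N, p), multiplied by a sign and
    by (z/2)^N. *)
Lemma bessel_coef_rec (z : R) (k p : nat) : z <> 0 ->
  (bessel_coef z k (S p) - 2 / z * bessel_coef z (S k) (S p) = bessel_coef z (S (S k)) p)%R.
Proof.
intros Hz. unfold bessel_coef.
replace (2 * S p + k)%nat with (S (S (2 * p + k))) by lia.
replace (2 * S p + S k)%nat with (S (S (S (2 * p + k)))) by lia.
replace (2 * p + S (S k))%nat with (S (S (2 * p + k))) by lia.
replace (S p + k)%nat with (S (p + k)) by lia.
replace (S p + S k)%nat with (S (S (p + k))) by lia.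
replace (p + S (S k))%nat with (S (S (p + k))) by lia.
rewrite (fact_simpl (S (S (2 * p + k)))), (fact_simpl p), (fact_simpl (S (p + k))).
rewrite !mult_INR, <- !tech_pow_Rmult, !S_INR.
replace (INR (2 * p + k)) with (2 * INR p + INR k)%R
  by (rewrite plus_INR, mult_INR; reflexivity).
rewrite plus_INR.
assert (H1 := INR_fact_neq_0 p). assert (H2 := INR_fact_neq_0 (S (p + k))).
assert (H3 := pos_INR p). assert (H4 := pos_INR k).
field. repeat split; try assumption; lra.
Qed.

(** The central case binom(2p+2, p+1) = 2 binom(2p+1, p) of the same rule; it encodes J_0' =
    -J_1. *)
Lemma bessel_coef_0_S (z : R) (p : nat) :
  (bessel_coef z 0 (S p) = - (z * bessel_coef z 1 p))%R.
Proof.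
unfold bessel_coef.
replace (2 * S p + 0)%nat with (S (S (2 * p))) by lia.
replace (2 * p + 1)%nat with (S (2 * p)) by lia.
replace (S p + 0)%nat with (S p) by lia.
replace (p + 1)%nat with (S p) by lia.
rewrite (fact_simpl (S (2 * p))), (fact_simpl p).
rewrite !mult_INR, <- !tech_pow_Rmult, !S_INR, !mult_INR.
assert (H1 := INR_fact_neq_0 p). assert (H3 := pos_INR p).
simpl (INR 2). field. repeat split; try assumption; lra.
Qed.

(** The transform of 2 J_{k+1}' = J_k - J_{k+2}, with no boundary term since J_{k+1}(0) = 0. *)
Lemma bessel_laplace_rec (z : R) (s : C) (k : nat) :
  0 < z -> 2 * z < Re s ->
  (bessel_laplace z s k - 2 * s / RtoC z * bessel_laplace z s (S k) =
   bessel_laplace z s (S (S k)))%C.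
Proof.
intros Hz Hs.
assert (Hs0 : s <> 0%C) by (intros E; rewrite E in Hs; simpl in Hs; lra).
assert (Hz0 : RtoC z <> 0%C) by (intros E; apply RtoC_inj in E; lra).
assert (H20 : RtoC 2 <> 0%C) by (intros E; apply RtoC_inj in E; lra).
assert (H0 := proj1 (is_Laplace_BesselJ_series z s k Hz Hs)).
assert (H1 := proj1 (is_Laplace_BesselJ_series z s (S k) Hz Hs)).
assert (H2 := proj1 (is_Laplace_BesselJ_series z s (S (S k)) Hz Hs)).
apply (is_series_linear _ _ _ (is_linear_Cmult_l (2 * s / RtoC z)%C)) in H1.
assert (H3 := is_series_minus (V := C_R_NormedModule) _ _ _ _ H0 H1).
apply CSeries_unique in H3.
change (bessel_laplace z s k - 2 * s / RtoC z * bessel_laplace z s (S k))%C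
  with (plus (bessel_laplace z s k : C_R_NormedModule)
             (opp (2 * s / RtoC z * bessel_laplace z s (S k))%C)).
etransitivity; [symmetry; exact H3 |].
apply CSeries_unique. apply (is_series_decr_1 (V := C_R_NormedModule)).
(* The terms p = 0 cancel, so dropping them and shifting the index leaves exactly the series of
   order k+2. *)
assert (E0 : (bessel_laplace_term z s k 0 -
              2 * s / RtoC z * bessel_laplace_term z s (S k) 0 = 0)%C).
{ unfold bessel_laplace_term. rewrite !bessel_coef_0, !RtoC_pow, !RtoC_div by lra.
  simpl. field. repeat split; try apply Cpow_nz; assumption. }
match goal with |- is_series _ ?v =>
  assert (E1 : v = bessel_laplace z s (S (S k))) end.
{ change (bessel_laplace z s (S (S k)) - (bessel_laplace_term z s k 0 -
          2 * s / RtoC z * bessel_laplace_term z s (S k) 0)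
          = bessel_laplace z s (S (S k)))%C. rewrite E0. ring. }
rewrite E1. revert H2. apply is_series_ext. intros p.
change (bessel_laplace_term z s (S (S k)) p =
        bessel_laplace_term z s k (S p) - 2 * s / RtoC z * bessel_laplace_term z s (S k) (S p))%C.
unfold bessel_laplace_term. rewrite <- (bessel_coef_rec z k p) by lra.
replace (2 * S p + k)%nat with (S (S (2 * p + k))) by lia.
replace (2 * S p + S k)%nat with (S (S (S (2 * p + k)))) by lia.
replace (2 * p + S (S k))%nat with (S (S (2 * p + k))) by lia.
rewrite RtoC_minus, RtoC_mult, RtoC_div, !(Cpow_S s) by lra.
field. repeat split; try apply Cpow_nz; assumption.
Qed.

(** The transform of J_0' = -J_1; the 1 is the boundary value J_0(0) and appears here as the term p
    = 0. *)
Lemma bessel_laplace_0_1 (z : R) (s : C) :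
  0 < z -> 2 * z < Re s ->
  (s * bessel_laplace z s 0 = 1 - RtoC z * bessel_laplace z s 1)%C.
Proof.
intros Hz Hs.
assert (Hs0 : s <> 0%C) by (intros E; rewrite E in Hs; simpl in Hs; lra).
assert (H0 := proj1 (is_Laplace_BesselJ_series z s 0 Hz Hs)).
assert (H1 := proj1 (is_Laplace_BesselJ_series z s 1 Hz Hs)).
apply (is_series_linear _ _ _ (is_linear_Cmult_l s)) in H0.
apply (is_series_linear _ _ _ (is_linear_Cmult_l (- RtoC z)%C)) in H1.
apply CSeries_unique in H0. etransitivity; [symmetry; exact H0 |].
apply CSeries_unique. apply (is_series_decr_1 (V := C_R_NormedModule)).
match goal with |- is_series _ ?v =>
  assert (E1 : v = (- RtoC z * bessel_laplace z s 1)%C) end.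
{ change (1 - RtoC z * bessel_laplace z s 1 - (s * bessel_laplace_term z s 0 0)
          = - RtoC z * bessel_laplace z s 1)%C.
  unfold bessel_laplace_term. rewrite bessel_coef_0. simpl. field. exact Hs0. }
rewrite E1. revert H1. apply is_series_ext. intros p.
match goal with |- ?a = ?b => change (a = b :> C) end.
unfold bessel_laplace_term. rewrite bessel_coef_0_S.
replace (2 * S p + 0)%nat with (S (S (2 * p))) by lia.
replace (2 * p + 1)%nat with (S (2 * p)) by lia.
rewrite RtoC_opp, RtoC_mult, !(Cpow_S s).
field. split; [apply Cpow_nz |]; exact Hs0.
Qed.

(** * The square root branch and the closed form *)

Lemma Cmod_Ci : Cmod Ci = 1.
Proof.
unfold Cmod; simpl.
replace (0 * (0 * 1) + 1 * (1 * 1))%R with 1 by ring. apply sqrt_1.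
Qed.

(** Along the vertical segment from Re s to s the real part of the branch is continuous, positive at
    the start and never zero, so the intermediate value theorem keeps it positive. *)
Lemma sqrt_branch_Re_pos (z : R) (r : C -> C) (s : C) :
  0 < z -> is_sqrt_branch z r -> 0 < Re s -> 0 < Re (r s).
Proof.
intros Hz [Hsq [Hder Hpos]] Hs. destruct s as [a b]. change (0 < a) in Hs.
set (g := fun tau : R => Re (r (a, tau * b)%R)).
assert (Hg : continuity g).
{ intros tau. apply continuity_pt_filterlim, filterlim_locally. intros eps.
  assert (Hc := ex_derive_continuous (V := C_NormedModule) r (a, tau * b)%R
                  (Hder (a, tau * b)%R Hs)).
  destruct (proj1 (filterlim_locally _ _) Hc eps) as [d Hd].
  (* The argument moves by |t - tau| |b|; the added 1 covers the case b = 0. *)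
  assert (Hb : 0 < d / (Rabs b + 1)).
  { apply Rdiv_lt_0_compat; [apply cond_pos |]. generalize (Rabs_pos b). lra. }
  exists (mkposreal _ Hb). intros t Ht.
  change (Rabs (t - tau) < d / (Rabs b + 1)) in Ht.
  assert (Hd' : Cmod ((a, t * b)%R - (a, tau * b)%R)%C < d).
  { replace ((a, t * b)%R - (a, tau * b)%R)%C with (RtoC ((t - tau) * b) * Ci)%C
      by (apply injective_projections; simpl; ring).
    rewrite Cmod_mult, Cmod_R, Rabs_mult.
    rewrite Cmod_Ci, Rmult_1_r.
    apply Rmult_lt_compat_r with (r := (Rabs b + 1)%R) in Ht;
      [| generalize (Rabs_pos b); lra].
    replace (d / (Rabs b + 1) * (Rabs b + 1))%R with (pos d) in Ht
      by (field; generalize (Rabs_pos b); lra).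
    generalize (Rabs_pos b) (Rabs_pos (t - tau)). nra. }
  specialize (Hd (a, t * b)%R Hd').
  change (Rabs (Re (r (a, t * b)%R - r (a, tau * b)%R)%C) < eps).
  exact (proj1 Hd). }
(* If Re r = 0, then r^2 is real and nonpositive, whereas s^2 + z^2 with Re s > 0 is real only on
   the real axis, where it is positive. *)
assert (Hne : forall tau, g tau <> 0).
{ intros tau E. unfold g in E.
  generalize (Hsq (a, tau * b)%R Hs). destruct (r (a, tau * b)%R) as [u v].
  simpl in E. subst u. intros E.
  assert (E1 := f_equal fst E). assert (E2 := f_equal snd E).
  simpl in E1, E2.
  assert (Ht : (tau * b = 0)%R) by nra. rewrite Ht in E1. nra. }
assert (H0 : 0 < g 0).
{ unfold g. rewrite Rmult_0_l. apply (Hpos a Hs). }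
replace (r (a, b)) with (r (a, 1 * b)%R) by (rewrite Rmult_1_l; reflexivity).
change (0 < g 1).
destruct (Rlt_le_dec 0 (g 1)) as [H1 | H1]; [exact H1 | exfalso].
destruct (IVT_cor g 0 1 Hg) as [tau [_ Htau]]; [lra | nra |].
exact (Hne tau Htau).
Qed.

(** The product (r - s)(r + s) equals z^2, so it suffices that |r - s| < |r + s|, that is Re r Re s
    + Im r Im s > 0. Comparing imaginary parts of r^2 and s^2 gives Re r Im r = Re s Im s, hence Im
    r and Im s do not have opposite signs. *)
Lemma Cmod_lt_1_root (z : R) (s r : C) :
  0 < z -> 0 < Re s -> 0 < Re r -> (r ^ 2 = s ^ 2 + RtoC z ^ 2)%C ->
  Cmod ((r - s) / RtoC z)%C < 1.
Proof.
intros Hz Hs Hr E.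
assert (Hz0 : RtoC z <> 0%C) by (intros E0; apply RtoC_inj in E0; lra).
assert (Hlt : Cmod (r - s)%C < Cmod (r + s)%C).
{ destruct r as [u v], s as [a b]. simpl in Hr, Hs.
  assert (E2 := f_equal snd E). simpl in E2.
  assert (Huv : (u * v = a * b)%R) by lra.
  assert (Hbv : 0 <= b * v).
  { apply Rmult_le_reg_l with u; [exact Hr |].
    replace (u * (b * v))%R with (b * (u * v))%R by ring. rewrite Huv. nra. }
  unfold Cmod. apply sqrt_lt_1_alt. split.
  - apply Rplus_le_le_0_compat; apply pow2_ge_0.
  - assert (Hua : 0 < u * a) by (apply Rmult_lt_0_compat; assumption). simpl. lra. }
assert (Hprod : (Cmod (r - s)%C * Cmod (r + s)%C = z * z)%R).
{ rewrite <- Cmod_mult.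
  replace ((r - s) * (r + s))%C with (RtoC (z * z)).
  - rewrite Cmod_R, Rabs_pos_eq; nra.
  - rewrite RtoC_mult. transitivity (r ^ 2 - s ^ 2)%C; [rewrite E |]; ring. }
rewrite Cmod_div, Cmod_R, Rabs_pos_eq by (assumption || lra).
apply Rmult_lt_reg_r with z; [exact Hz |]. unfold Rdiv.
rewrite Rmult_assoc, Rinv_l, Rmult_1_r, Rmult_1_l by lra.
generalize (Cmod_ge_0 (r - s)%C). nra.
Qed.

(** * Selection of the decaying solution *)

Lemma is_series_C_lim_0 (a : nat -> C) (l : C) :
  is_series (V := C_R_NormedModule) a l -> is_lim_seq (fun k => Cmod (a k)) 0.
Proof.
intros Ha.
assert (H1 := ex_series_lim_0 _ (ex_intro _ _ (is_series_Re a l Ha))).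
assert (H2 := ex_series_lim_0 _ (ex_intro _ _ (is_series_Im a l Ha))).
apply is_lim_seq_le_le with (fun _ => 0) (fun k => Rabs (Re (a k)) + Rabs (Im (a k)))%R.
- intros k. split; [apply Cmod_ge_0 |].
  replace (a k) with (RtoC (Re (a k)) + Ci * RtoC (Im (a k)))%C at 1
    by (apply injective_projections; simpl; unfold Re, Im; ring).
  eapply Rle_trans; [apply Cmod_triangle |].
  rewrite Cmod_mult, !Cmod_R, Cmod_Ci. lra.
- apply is_lim_seq_const.
- replace (Finite 0) with (Rbar_plus (Finite 0) (Finite 0)) by (simpl; f_equal; ring).
  apply is_lim_seq_plus'.
  + apply -> is_lim_seq_abs_0. exact H1.
  + apply -> is_lim_seq_abs_0. exact H2.
Qed.

(** The moduli cannot decrease with k, yet they tend to 0. This excludes growth like (-1/q)^k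
    without dividing by q. *)
Lemma backward_contraction_eq_0 (d : nat -> C) (q : C) :
  Cmod q < 1 -> (forall k, d k = - q * d (S k))%C ->
  is_lim_seq (fun k => Cmod (d k)) 0 -> d 0%nat = 0%C.
Proof.
intros Hq Hd Hlim.
assert (Hle : forall k, Cmod (d 0%nat) <= Cmod (d k)).
{ induction k as [|k IH]; [apply Rle_refl |].
  eapply Rle_trans; [exact IH |].
  rewrite Hd, Cmod_mult, Cmod_opp.
  generalize (Cmod_ge_0 (d (S k))). nra. }
apply Cmod_eq_0. apply Rle_antisym; [| apply Cmod_ge_0].
apply (is_lim_seq_le (fun _ => Cmod (d 0%nat)) (fun k => Cmod (d k))
         (Finite (Cmod (d 0%nat))) (Finite 0)); [exact Hle | apply is_lim_seq_const | exact Hlim].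
Qed.

(** The difference L_{k+1} - q L_k removes the q^k component of a solution and keeps a multiple of
    (-1/q)^k, which decay forces to vanish. The initial value follows from r L_0 = s L_0 + z q L_0 =
    s L_0 + z L_1 = 1. *)
Lemma bessel_laplace_closed_form (z : R) (s r : C) (k : nat) :
  0 < z -> 2 * z < Re s -> 0 < Re r -> (r ^ 2 = s ^ 2 + RtoC z ^ 2)%C ->
  bessel_laplace z s k = (((r - s) / RtoC z) ^ k / r)%C.
Proof.
intros Hz Hs Hr E. set (q := ((r - s) / RtoC z)%C). set (L := bessel_laplace z s).
assert (Hz0 : RtoC z <> 0%C) by (intros E0; apply RtoC_inj in E0; lra).
assert (Hr0 : r <> 0%C) by (intros E0; rewrite E0 in Hr; simpl in Hr; lra).
assert (Hq : Cmod q < 1) by (apply Cmod_lt_1_root; [| lra | |]; assumption).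
assert (Hzq : (RtoC z * q = r - s)%C) by (unfold q; field; exact Hz0).
(* The characteristic equation of the recurrence, equivalent to (r - s)^2 + 2 s (r - s) = r^2 - s^2
   = z^2. *)
assert (Hq2 : (2 * s / RtoC z * q = 1 - q * q)%C).
{ replace (1 - q * q)%C with ((RtoC z ^ 2 - (RtoC z * q) * (RtoC z * q)) / RtoC z ^ 2)%C
    by (field; exact Hz0).
  rewrite Hzq. replace (RtoC z ^ 2)%C with (r ^ 2 - s ^ 2)%C at 1 by (rewrite E; ring).
  unfold q. field. exact Hz0. }
(* The bounds on J_k(z t) are summable in k, hence so are the transforms, and their terms tend to
   0. *)
assert (Hlim : is_lim_seq (fun k => Cmod (L k)) 0).
{ destruct (is_Laplace_series (fun k t => RtoC (BesselJ k (z * t))) L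
              (fun k => 4 / 3 * (1 / 2) ^ k)%R (2 * z)%R s Hs) as [S [HS _]].
  - intros j t Ht. rewrite Cmod_R, (Rmult_assoc 2). apply BesselJ_bound. nra.
  - eexists. apply (is_series_scal_l (V := R_NormedModule)), is_series_geom.
    rewrite Rabs_pos_eq; lra.
  - intros j. apply is_Laplace_BesselJ_series; assumption.
  - apply (is_series_C_lim_0 _ _ HS). }
assert (Hrec : forall j, (q * L (S (S j)) = q * L j - (1 - q * q) * L (S j))%C).
{ intros j. unfold L. rewrite <- (bessel_laplace_rec z s j Hz Hs), <- Hq2. ring. }
assert (H0 : (L 1%nat - q * L 0%nat = 0)%C).
{ apply (backward_contraction_eq_0 (fun j => L (S j) - q * L j)%C q Hq).
  - intros j. transitivity (- (q * L (S (S j))) + q * q * L (S j))%C; [| ring].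
    rewrite Hrec. ring.
  - apply is_lim_seq_le_le with (fun _ => 0) (fun j => Cmod (L (S j)) + Cmod (L j))%R.
    + intros j. split; [apply Cmod_ge_0 |]. unfold Cminus.
      eapply Rle_trans; [apply Cmod_triangle |].
      rewrite Cmod_opp, Cmod_mult. generalize (Cmod_ge_0 (L j)). nra.
    + apply is_lim_seq_const.
    + replace (Finite 0) with (Rbar_plus (Finite 0) (Finite 0)) by (simpl; f_equal; ring).
      apply is_lim_seq_plus'; [apply (is_lim_seq_incr_1 (fun j => Cmod (L j))) |]; exact Hlim. }
assert (HL0 : L 0%nat = (/ r)%C).
{ assert (H1 := bessel_laplace_0_1 z s Hz Hs). fold L in H1.
  assert (H2 : (r * L 0%nat = 1)%C).
  { replace r with (RtoC z * q + s)%C by (rewrite Hzq; ring).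
    replace ((RtoC z * q + s) * L 0%nat)%C
      with (s * L 0%nat + RtoC z * L 1%nat - RtoC z * (L 1%nat - q * L 0%nat))%C by ring.
    rewrite H0, H1. ring. }
  replace (L 0%nat) with (/ r * (r * L 0%nat))%C by (field; exact Hr0).
  rewrite H2. ring. }
assert (HS : forall j, (L (S j) - q * L j = 0)%C).
(* The value q = 0 would turn the characteristic equation into 0 = 1; for q nonzero the vanishing
   propagates upwards by division by q. *)
{ destruct (Ceq_dec q 0) as [Eq | Hq0].
  - intros j. exfalso. rewrite Eq in Hq2.
    assert (H01 : (RtoC 0 = RtoC 1)%C)
      by (transitivity (2 * s / RtoC z * 0)%C; [ring | rewrite Hq2; ring]).
    apply RtoC_inj in H01. lra.
  - induction j as [|j IH]; [exact H0 |].
    transitivity (/ q * (q * L (S (S j)) - q * (q * L (S j))))%C; [field; exact Hq0 |].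
    rewrite Hrec. transitivity (- / q * (L (S j) - q * L j))%C; [ring |].
    rewrite IH. ring. }
induction k as [|k IH].
- fold (L 0%nat). rewrite HL0. simpl. field. exact Hr0.
- fold (L (S k)). fold (L k) in IH.
  transitivity (L (S k) - q * L k + q * L k)%C; [ring |].
  rewrite HS, IH. simpl. field. exact Hr0.
Qed.

(** * Generating functions of bounded second-order recurrences *)

(** Multiplying by the characteristic polynomial telescopes all but the first two terms. The result
    is stated as a product, not a quotient, so that it can also serve to prove that the denominator
    is nonzero. *)
Lemma is_series_second_order_rec (u : nat -> R) (w M : R) (Q : C) :
  (forall k, u (S (S k)) = 2 * w * u (S k) - u k)%R ->
  (forall k, Rabs (u k) <= M) -> Cmod Q < 1 ->
  exists S : C, is_series (V := C_R_NormedModule) (fun k => Q ^ k * RtoC (u k))%C S /\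
    (S * (1 - 2 * RtoC w * Q + Q * Q)
     = RtoC (u 0%nat) + Q * RtoC (u 1%nat - 2 * w * u 0%nat))%C.
Proof.
intros Hu HM HQ.
set (a := fun k => (Q ^ k * RtoC (u k))%C).
assert (Hex : exists S0 : C, is_series (V := C_R_NormedModule) a S0).
{ apply (ex_series_le (V := C_R_CompleteNormedModule) a (fun k => Cmod Q ^ k * M)%R).
  - intros k. change (@norm R_AbsRing C_R_NormedModule (a k) <= Cmod Q ^ k * M).
    rewrite norm_C_R. unfold a. rewrite Cmod_mult, Cmod_pow, Cmod_R.
    apply Rmult_le_compat_l; [apply pow_le, Cmod_ge_0 | apply HM].
  - eexists. apply is_series_scal_r, is_series_geom.
    rewrite Rabs_pos_eq; [exact HQ | apply Cmod_ge_0]. }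
destruct Hex as [S0 HS0]. exists S0. split; [exact HS0 |].
assert (H1 : is_series (V := C_R_NormedModule) (fun k => a (S k)) (S0 - a 0%nat)%C).
{ apply (is_series_incr_1 (V := C_R_NormedModule)).
  refine (eq_ind _ (is_series (V := C_R_NormedModule) a) HS0 _ _).
  change (S0 = S0 - a 0%nat + a 0%nat)%C. ring. }
assert (H2 : is_series (V := C_R_NormedModule) (fun k => a (S (S k)))
               (S0 - a 0%nat - a 1%nat)%C).
{ apply (is_series_incr_1 (V := C_R_NormedModule) (fun k => a (S k))).
  refine (eq_ind _ (is_series (V := C_R_NormedModule) (fun k => a (S k))) H1 _ _).
  change (S0 - a 0%nat = S0 - a 0%nat - a 1%nat + a 1%nat)%C. ring. }
assert (H3 := is_series_plus (V := C_R_NormedModule) _ _ _ _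
   (is_series_linear _ _ _ (is_linear_Cmult_l (2 * RtoC w * Q)%C) H1)
   (is_series_linear _ _ _ (is_linear_Cmult_l (- (Q * Q))%C) HS0)).
assert (E : (S0 - a 0%nat - a 1%nat = 2 * RtoC w * Q * (S0 - a 0%nat) + - (Q * Q) * S0)%C).
{ rewrite <- (CSeries_unique _ _ H2). apply CSeries_unique.
  revert H3. apply is_series_ext. intros k.
  change (2 * RtoC w * Q * a (S k) + - (Q * Q) * a k = a (S (S k)))%C.
  unfold a. rewrite Hu, RtoC_minus, !RtoC_mult. simpl. ring. }
transitivity ((S0 - a 0%nat - a 1%nat) - (2 * RtoC w * Q * (S0 - a 0%nat) + - (Q * Q) * S0)
              + (a 0%nat + a 1%nat - 2 * RtoC w * Q * a 0%nat))%C; [ring |].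
rewrite E. unfold a. rewrite RtoC_minus, !RtoC_mult. simpl. ring.
Qed.

(** * The kernel sums *)

(** Since L_{kn+m} = q^{kn+m} / r, the k-th term transforms into a fixed factor times Q^k u_k. The
    offsets [b] and [m] allow a sum over k >= 1 to be reindexed from 0 with b = n. *)
Lemma is_Laplace_bessel_sum (n m b : nat) (z w M : R) (s r : C) (u : nat -> R) :
  (1 <= n)%nat -> 0 < z -> 2 * z < Re s -> 0 < Re r ->
  (r ^ 2 = s ^ 2 + RtoC z ^ 2)%C ->
  (forall k, u (S (S k)) = 2 * w * u (S k) - u k)%R ->
  (forall k, Rabs (u k) <= M) ->
  let q := ((r - s) / RtoC z)%C in
  let Q := ((- Ci * q) ^ n)%C in
  (1 - 2 * RtoC w * Q + Q * Q <> 0)%C ->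
  is_Laplace
    (fun t => CSeries (fun k => (- Ci) ^ (k * n + b)
                         * RtoC (BesselJ (k * n + m) (z * t)) * RtoC (u k))%C) s
    ((- Ci) ^ b * q ^ m / r
     * ((RtoC (u 0%nat) + Q * RtoC (u 1%nat - 2 * w * u 0%nat))
        / (1 - 2 * RtoC w * Q + Q * Q)))%C.
Proof.
intros Hn Hz Hs Hr E Hu HM q Q HD.
assert (Hr0 : r <> 0%C) by (intros E0; rewrite E0 in Hr; simpl in Hr; lra).
assert (HM0 : 0 <= M) by (eapply Rle_trans; [apply Rabs_pos | apply (HM 0%nat)]).
assert (HCi : forall k, Cmod ((- Ci) ^ k) = 1).
{ intros k. rewrite Cmod_pow, Cmod_opp, Cmod_Ci. apply pow1. }
assert (Hq : Cmod q < 1) by (apply Cmod_lt_1_root; [| lra | |]; assumption).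
assert (HQ : Cmod Q < 1).
{ unfold Q. rewrite Cmod_pow, Cmod_mult, Cmod_opp, Cmod_Ci, Rmult_1_l.
  destruct n as [|n]; [lia |]. simpl.
  assert (H := pow_le (Cmod q) n (Cmod_ge_0 q)).
  assert (H' : Cmod q ^ n <= 1).
  { rewrite <- (pow1 n). apply pow_incr. split; [apply Cmod_ge_0 | lra]. }
  generalize (Cmod_ge_0 q). nra. }
destruct (is_series_second_order_rec u w M Q Hu HM HQ) as [S0 [HS0 ES0]].
apply (is_series_linear _ _ _ (is_linear_Cmult_l ((- Ci) ^ b * q ^ m / r)%C)) in HS0.
destruct (is_Laplace_series
            (fun k t => (- Ci) ^ (k * n + b) * RtoC (BesselJ (k * n + m) (z * t)) * RtoC (u k))%C
            (fun k => (- Ci) ^ b * q ^ m / r * (Q ^ k * RtoC (u k)))%C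
            (fun k => 4 / 3 * M * (1 / 2) ^ k)%R (2 * z)%R s Hs) as [L [HL1 HL2]].
- intros k t Ht. rewrite !Cmod_mult, HCi, Rmult_1_l, !Cmod_R, (Rmult_assoc 2).
  replace (4 / 3 * M * (1 / 2) ^ k * exp (2 * (z * t)))%R
    with (4 / 3 * (1 / 2) ^ k * exp (2 * (z * t)) * M)%R by ring.
  apply Rmult_le_compat; [apply Rabs_pos | apply Rabs_pos | | apply HM].
  eapply Rle_trans; [apply BesselJ_bound, Rmult_le_pos; lra |].
  apply Rmult_le_compat_r; [left; apply exp_pos |].
  apply Rmult_le_compat_l; [lra |].
  (* As n >= 1, the factor 2^{-(kn+m)} is at most 2^{-k}, which gives a dominating geometric
     series. *)
  replace (k * n + m)%nat with (k + (k * (n - 1) + m))%nat by nia.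
  rewrite pow_add. rewrite <- (Rmult_1_r ((1 / 2) ^ k)) at 2.
  apply Rmult_le_compat_l; [apply pow_le; lra |].
  eapply Rle_trans; [apply pow_incr with (y := 1); lra | rewrite pow1; lra].
- eexists. apply (is_series_scal_l (V := R_NormedModule)), is_series_geom.
  rewrite Rabs_pos_eq; lra.
- intros k.
  apply is_Laplace_ext with
    (fun t => (- Ci) ^ (k * n + b) * RtoC (u k) * RtoC (BesselJ (k * n + m) (z * t)))%C.
  + intros t _. ring.
  + replace ((- Ci) ^ b * q ^ m / r * (Q ^ k * RtoC (u k)))%C
      with ((- Ci) ^ (k * n + b) * RtoC (u k) * bessel_laplace z s (k * n + m))%C.
    * apply is_Laplace_Cmult_l, is_Laplace_BesselJ_series; assumption.
    * rewrite (bessel_laplace_closed_form z s r) by assumption. fold q. unfold Q.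
      rewrite !Cpow_add_r, <- Cpow_mult_r, (Nat.mul_comm n k), Cpow_mult_l.
      field. exact Hr0.
- assert (EL : L = ((- Ci) ^ b * q ^ m / r * S0)%C).
  { rewrite <- (CSeries_unique _ _ HL1). apply CSeries_unique, HS0. }
  rewrite <- ES0.
  replace (S0 * (1 - 2 * RtoC w * Q + Q * Q) / (1 - 2 * RtoC w * Q + Q * Q))%C
    with S0 by (field; exact HD).
  rewrite <- EL. exact HL2.
Qed.

(** At a zero of the denominator the generating function of cos (k theta) forces its numerator 1 - Q
    cos theta to vanish as well; then Q cos theta = 1 gives Q^2 = 1, against |Q| < 1. *)
Lemma chebyshev_denominator_neq_0 (theta : R) (Q : C) : Cmod Q < 1 ->
  (1 - 2 * RtoC (cos theta) * Q + Q * Q <> 0)%C.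
Proof.
intros HQ E.
destruct (is_series_second_order_rec (fun k => cos (INR k * theta)) (cos theta) 1 Q)
  as [S0 [_ ES0]].
- intros k. rewrite !S_INR.
  replace ((INR k + 1 + 1) * theta)%R with ((INR k + 1) * theta + theta)%R by ring.
  replace (INR k * theta)%R with ((INR k + 1) * theta - theta)%R by ring.
  rewrite cos_plus, cos_minus. ring.
- intros k. apply Rabs_le. apply COS_bound.
- exact HQ.
- rewrite E in ES0. simpl INR in ES0. rewrite Rmult_0_l, Rmult_1_l, cos_0 in ES0.
  assert (H1 : (Q * RtoC (cos theta) = 1)%C).
  { transitivity (1 - (1 + Q * RtoC (cos theta - 2 * cos theta * 1)))%C.
    - rewrite RtoC_minus, !RtoC_mult. ring.
    - rewrite <- ES0. ring. }
  assert (H2 : (Q * Q = 1)%C).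
  { transitivity ((1 - 2 * RtoC (cos theta) * Q + Q * Q) + 2 * (Q * RtoC (cos theta)) - 1)%C;
      [ring |]. rewrite E, H1. ring. }
  assert (H3 := f_equal Cmod H2). rewrite Cmod_mult, Cmod_1 in H3.
  generalize (Cmod_ge_0 Q). nra.
Qed.

(** * Plane vectors, bivectors and powers of -i *)

Lemma CSeries_ext (a b : nat -> C) : (forall k, a k = b k) -> CSeries a = CSeries b.
Proof.
intros H. unfold CSeries. f_equal; apply Series_ext; intros k; rewrite H; reflexivity.
Qed.

Lemma dot2_pos (x : R * R) : x <> (0, 0) -> 0 < dot2 x x.
Proof.
destruct x as [a b]. intros H. unfold dot2; simpl.
destruct (Req_dec a 0) as [-> | Ha]; [destruct (Req_dec b 0) as [-> | Hb] |].
- contradiction.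
- nra.
- nra.
Qed.

(** Lagrange's identity in the plane: the squared bivector coefficient is z^2 (1 - w^2). It gives
    |w| <= 1 and makes the bivector vanish together with sin theta. *)
Lemma wedge_sqr (x y : R * R) :
  ((fst x * snd y - snd x * fst y) ^ 2 + dot2 x y ^ 2 = (norm2 x * norm2 y) ^ 2)%R.
Proof.
unfold norm2. rewrite Rpow_mult_distr, !pow2_sqrt.
- unfold dot2. ring.
- unfold dot2. nra.
- unfold dot2. nra.
Qed.

(** Both the kernel and its claimed transform have this shape, so the Clifford-valued statement
    reduces to one scalar and one bivector coordinate. *)
Lemma cl_scalar_bivector (x y : R * R) (a b : C) :
  cl_plus (cl_of_C a) (cl_mult (wedge x y) (cl_of_C b)) =
  mkCl a 0 0 (RtoC (fst x * snd y - snd x * fst y) * b).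
Proof. unfold cl_plus, wedge, cl_scal, cl_of_C. simpl. f_equal; ring. Qed.

Lemma Cpow_m1_sqr (k : nat) : ((-1) ^ k * (-1) ^ k = 1)%C.
Proof.
rewrite <- Cpow_mult_l. replace (-1 * -1)%C with (RtoC 1) by ring. apply Cpow_1_l.
Qed.

Lemma Cpow_m_Ci_odd (k : nat) : ((- Ci) ^ (2 * k + 1) = (-1) ^ k * - Ci)%C.
Proof.
rewrite Cpow_add_r, Cpow_mult_r, Cpow_1_r. do 2 f_equal.
apply injective_projections; simpl; ring.
Qed.

Lemma Ci_sqr : (Ci * Ci = -1)%C.
Proof. apply injective_projections; simpl; ring. Qed.

Theorem theorem3p2 :
  forall (nt n : nat) (c : R),
  (1 <= nt)%nat -> n = (2 * nt + 1)%nat -> (1 + c = 1 / INR n)%R ->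
  forall x y : R * R, x <> (0, 0)%R -> y <> (0, 0)%R ->
  let z := (norm2 x * norm2 y)%R in
  let w := (dot2 x y / z)%R in
  forall sqrt_s2z2 : C -> C, is_sqrt_branch z sqrt_s2z2 ->
  exists sigma : R, forall s : C, (sigma < Re s)%R ->
  let r := sqrt_s2z2 s in
  let den := ((s + r) ^ n - 2 * RtoC w * (- Ci * RtoC z) ^ n
              + (-1) ^ n * (r - s) ^ n)%C in
  is_Laplace_Cl (K2 n nt x y) s
    (cl_plus
       (cl_plus
          (cl_of_C (1 / r * (((s + r) ^ (nt + 1)
                              + (-1) ^ nt * (r - s) ^ (nt + 1)) / den)))
          (cl_of_C (RtoC w * RtoC z * (Ci / r)
                    * (((-1) ^ nt * (r - s) ^ nt - (s + r) ^ nt) / den))))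
       (cl_mult (wedge x y)
          (cl_of_C (Ci / r
                    * (((-1) ^ nt * (r - s) ^ nt - (s + r) ^ nt) / den))))).
Proof.
intros nt n c _ Hn _ x y Hx Hy z w rs Hrs.
assert (Hz : 0 < z) by (apply Rmult_lt_0_compat; apply sqrt_lt_R0, dot2_pos; assumption).
assert (Hwz : (dot2 x y = w * z)%R) by (unfold w; field; lra).
set (lam := (fst x * snd y - snd x * fst y)%R).
assert (Hlam : (lam ^ 2 = z ^ 2 * (1 - w ^ 2))%R).
{ assert (H := wedge_sqr x y). fold z lam in H. rewrite Hwz in H. lra. }
assert (Hw : -1 <= w <= 1).
{ assert (H : 0 <= z ^ 2 * (1 - w ^ 2)) by (rewrite <- Hlam; apply pow2_ge_0).
  assert (H' : 0 <= 1 - w ^ 2).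
  { apply Rmult_le_reg_l with (z ^ 2)%R; [apply pow_lt, Hz | lra]. }
  nra. }
set (theta := acos w).
assert (Hcos : cos theta = w) by (apply cos_acos, Hw).
exists (2 * z)%R. intros s Hs r den.
assert (Hr : 0 < Re r) by (apply (sqrt_branch_Re_pos z rs s); [| | lra]; assumption).
assert (E : (r ^ 2 = s ^ 2 + RtoC z ^ 2)%C) by (apply (proj1 Hrs); lra).
assert (Hr0 : r <> 0%C) by (intros E0; rewrite E0 in Hr; simpl in Hr; lra).
assert (Hz0 : RtoC z <> 0%C) by (intros E0; apply RtoC_inj in E0; lra).
set (q := ((r - s) / RtoC z)%C).
assert (Hq1 : (r - s = RtoC z * q)%C) by (unfold q; field; exact Hz0).
assert (Hq2 : ((s + r) * q = RtoC z)%C).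
{ transitivity ((r ^ 2 - s ^ 2) / RtoC z)%C; [unfold q; field; exact Hz0 |].
  rewrite E. field. exact Hz0. }
assert (Hq0 : q <> 0%C) by (intros E0; apply Hz0; rewrite <- Hq2, E0; ring).
assert (Hq3 : (s + r = RtoC z / q)%C) by (rewrite <- Hq2; field; exact Hq0).
assert (Hq : Cmod q < 1) by (apply Cmod_lt_1_root; [| lra | |]; assumption).
set (Q := ((- Ci * q) ^ n)%C).
set (D := (1 - 2 * RtoC w * Q + Q * Q)%C).
assert (HQ : Cmod Q < 1).
{ unfold Q. rewrite Cmod_pow, Cmod_mult, Cmod_opp, Cmod_Ci, Rmult_1_l.
  apply pow_lt_1_compat; [| lia]. split; [apply Cmod_ge_0 | exact Hq]. }
assert (HD : D <> 0%C) by (unfold D; rewrite <- Hcos; apply chebyshev_denominator_neq_0, HQ).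
assert (Hn1 : (1 <= n)%nat) by lia.
set (P := ((-1) ^ nt)%C).
assert (HP : (P * P = 1)%C) by apply Cpow_m1_sqr.
set (a := (q ^ nt)%C). assert (Ha : a <> 0%C) by apply Cpow_nz, Hq0.
set (Z := (RtoC z ^ nt)%C). assert (HZ : Z <> 0%C) by apply Cpow_nz, Hz0.
assert (Hodd : forall v : C, (v ^ n = v ^ nt * v ^ nt * v)%C).
{ intros v. rewrite Hn. replace (2 * nt + 1)%nat with (nt + nt + 1)%nat by lia.
  rewrite !Cpow_add_r, Cpow_1_r. reflexivity. }
assert (HIn : ((- Ci) ^ n = P * - Ci)%C) by (rewrite Hn; apply Cpow_m_Ci_odd).
assert (HQe : (Q = P * - Ci * (a * a * q))%C)
  by (unfold Q; rewrite Cpow_mult_l, HIn, (Hodd q); reflexivity).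
assert (Hzq : ((RtoC z * q) ^ nt = Z * a)%C) by apply Cpow_mult_l.
assert (Hzdq : ((RtoC z / q) ^ nt = Z / a)%C)
  by (unfold Cdiv; rewrite Cpow_mult_l, Cpow_inv by exact Hq0; reflexivity).
(* The prefactor is (z/q)^n = (s + r)^n; the last term matches because (-1)^n q^{2n} = Q^2. *)
assert (Hden : (den = Z * Z * RtoC z / (a * a * q) * D)%C).
{ unfold den, D. rewrite Hq3, Hq1. unfold Cdiv at 1.
  rewrite !Cpow_mult_l, HIn, Cpow_inv by exact Hq0. rewrite !Hodd, HQe.
  (* With the powers of exponent [nt] made atomic, the identity is rational modulo the two relations
     P^2 = 1 and i^2 = -1. *)
  fold P a Z. field [HP Ci_sqr]. repeat split; assumption. }
set (X1 := (1 / r * (((s + r) ^ (nt + 1) + P * (r - s) ^ (nt + 1)) / den)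
            + RtoC w * RtoC z * (Ci / r * ((P * (r - s) ^ nt - (s + r) ^ nt) / den)))%C).
set (X2 := (Ci / r * ((P * (r - s) ^ nt - (s + r) ^ nt) / den))%C).
assert (Hcrec : forall k, (cos (INR (S (S k)) * theta) =
          2 * w * cos (INR (S k) * theta) - cos (INR k * theta))%R).
{ intros k. rewrite !S_INR.
  replace ((INR k + 1 + 1) * theta)%R with ((INR k + 1) * theta + theta)%R by ring.
  replace (INR k * theta)%R with ((INR k + 1) * theta - theta)%R by ring.
  rewrite cos_plus, cos_minus, Hcos. ring. }
assert (Hsrec : forall k, (sin (INR (S (S k)) * theta) =
          2 * w * sin (INR (S k) * theta) - sin (INR k * theta))%R).
{ intros k. rewrite !S_INR.
  replace ((INR k + 1 + 1) * theta)%R with ((INR k + 1) * theta + theta)%R by ring.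
  replace (INR k * theta)%R with ((INR k + 1) * theta - theta)%R by ring.
  rewrite sin_plus, sin_minus, Hcos. ring. }
assert (Hc2 : (cos (2 * theta) = 2 * w * w - 1)%R).
{ generalize (Hcrec 0%nat). simpl INR. rewrite Rmult_0_l, Rmult_1_l, cos_0, Hcos.
  replace (1 + 1)%R with 2 by ring. lra. }
assert (Hs2 : (sin (2 * theta) = 2 * w * sin theta)%R).
{ generalize (Hsrec 0%nat). simpl INR. rewrite Rmult_0_l, Rmult_1_l, sin_0.
  replace (1 + 1)%R with 2 by ring. lra. }
assert (Hqn : (q ^ (n - nt) = a * q)%C).
{ replace (n - nt)%nat with (nt + 1)%nat by lia. rewrite Cpow_add_r, Cpow_1_r. reflexivity. }
assert (Hqn' : (q ^ (n + nt) = a * a * a * q)%C).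
{ rewrite Cpow_add_r, Hodd. unfold a. ring. }
assert (Hscal : is_Laplace (K2_scal n nt z theta) s X1).
{ assert (L1 := is_Laplace_bessel_sum n nt 0 z w 1 s r (fun k => cos (INR k * theta))
     Hn1 Hz Hs Hr E Hcrec (fun k => proj2 (Rabs_le_between _ _) (COS_bound _)) HD).
  (* The sum over k >= 1 is taken at k + 1, which turns the order (k+1) n - nt into k n + (n -
     nt). *)
  assert (L2 := is_Laplace_bessel_sum n (n - nt) n z w 1 s r (fun k => cos (INR (S k) * theta))
     Hn1 Hz Hs Hr E (fun k => Hcrec (S k))
     (fun k => proj2 (Rabs_le_between _ _) (COS_bound _)) HD).
  cbv beta zeta in L1, L2. fold q Q D in L1, L2. rewrite Hqn, HIn in L2. fold a in L1.
  apply (is_Laplace_Cmult_l _ _ _ (/ Z)%C) in L1.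
  apply (is_Laplace_Cmult_l _ _ _ (P / Z)%C) in L2.
  assert (L3 := is_Laplace_plus _ _ _ _ _ L1 L2).
  match type of L3 with is_Laplace _ _ ?v => assert (EX : v = X1) end.
  (* The two generating functions have numerators 1 - w Q and w - Q. *)
  { unfold X1. rewrite Hden, Hq3, Hq1, !Cpow_add_r, !Cpow_1_r.
    rewrite Hzdq, Hzq.
    simpl INR. rewrite Rmult_0_l, !Rmult_1_l, cos_0, Hcos.
    replace (1 + 1)%R with 2 by ring. rewrite Hc2.
    rewrite !RtoC_minus, !RtoC_mult, HQe. simpl.
    field [HP Ci_sqr]. repeat split; assumption. }
  rewrite EX in L3. revert L3. apply is_Laplace_ext. intros t _.
  unfold K2_scal. fold Z P. unfold Cdiv.
  f_equal; f_equal; try ring; apply CSeries_ext; intros k; cbv zeta.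
  - rewrite Nat.add_0_r. reflexivity.
  - replace (k * n + n)%nat with (S k * n)%nat by (simpl; lia).
    replace (k * n + (n - nt))%nat with (S k * n - nt)%nat by (simpl; lia).
    reflexivity. }

assert (Hbiv : sin theta <> 0 -> is_Laplace (K2_biv n nt z theta) s X2).
{ intros Hsin.
  (* These are the Chebyshev values U_k(w), with U_0 = 1 and U_1 = 2 w, so their generating function
     has numerator 1. *)
  set (u := fun k => (sin (INR (S k) * theta) / sin theta)%R).
  assert (Hu : forall k, (u (S (S k)) = 2 * w * u (S k) - u k)%R).
  { intros k. unfold u. rewrite Hsrec. field. exact Hsin. }
  assert (Hub : forall k, Rabs (u k) <= / Rabs (sin theta)).
  { intros k. unfold u, Rdiv. rewrite Rabs_mult, Rabs_inv.
    rewrite <- (Rmult_1_l (/ Rabs (sin theta))) at 2. apply Rmult_le_compat_r.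
    - left. apply Rinv_0_lt_compat, Rabs_pos_lt, Hsin.
    - apply Rabs_le, SIN_bound. }
  assert (Hu0 : u 0%nat = 1) by (unfold u; simpl INR; rewrite Rmult_1_l; field; exact Hsin).
  assert (Hu1 : (u 1%nat = 2 * w)%R).
  { unfold u. simpl INR. replace (1 + 1)%R with 2 by ring. rewrite Hs2. field. exact Hsin. }
  assert (L1 := is_Laplace_bessel_sum n (n + nt) n z w _ s r u Hn1 Hz Hs Hr E Hu Hub HD).
  assert (L2 := is_Laplace_bessel_sum n (n - nt) n z w _ s r u Hn1 Hz Hs Hr E Hu Hub HD).
  cbv beta zeta in L1, L2. fold q Q D in L1, L2.
  rewrite Hqn, HIn, Hu0, Hu1 in L2. rewrite Hqn', HIn, Hu0, Hu1 in L1.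
  apply (is_Laplace_Cmult_l _ _ _ (- / (Z * RtoC z))%C) in L1.
  apply (is_Laplace_Cmult_l _ _ _ (P / (Z * RtoC z))%C) in L2.
  assert (L3 := is_Laplace_plus _ _ _ _ _ L1 L2).
  match type of L3 with is_Laplace _ _ ?v => assert (EX : v = X2) end.
  { unfold X2. rewrite Hden, Hq3, Hq1, Hzdq, Hzq.
    rewrite !RtoC_minus, !RtoC_mult.
    field [HP Ci_sqr]. repeat split; assumption. }
  rewrite EX in L3. revert L3. apply is_Laplace_ext. intros t _.
  unfold K2_biv. rewrite !Cpow_add_r, !Cpow_1_r. fold Z P. unfold Cdiv.
  assert (Hsq : forall k, sin_quot (S k) theta = u k).
  { intros k. unfold sin_quot. destruct (Req_EM_T (sin theta) 0); [contradiction | reflexivity]. }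
  f_equal; f_equal; try ring; apply CSeries_ext; intros k; cbv zeta; rewrite Hsq.
  - replace (k * n + n)%nat with (S k * n)%nat by (simpl; lia).
    replace (k * n + (n + nt))%nat with (S k * n + nt)%nat by (simpl; lia).
    reflexivity.
  - replace (k * n + n)%nat with (S k * n)%nat by (simpl; lia).
    replace (k * n + (n - nt))%nat with (S k * n - nt)%nat by (simpl; lia).
    reflexivity. }
assert (Hbiv' : is_Laplace (fun t => RtoC lam * K2_biv n nt z theta t)%C s (RtoC lam * X2)%C).
(* Here lam^2 = z^2 sin^2 theta, so in the degenerate case both sides are zero. *)
{ destruct (Req_dec (sin theta) 0) as [Hsin | Hsin].
  - assert (Hl0 : lam = 0).
    { generalize (sin2_cos2 theta). rewrite Hsin, Hcos. unfold Rsqr. intros H. nra. }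
    rewrite Hl0.
    assert (L0 := is_Laplace_monomial s 0 ltac:(lra)).
    apply (is_Laplace_Cmult_l _ _ _ 0%C) in L0.
    rewrite Cmult_0_l in L0 |- *. revert L0. apply is_Laplace_ext. intros t _. ring.
  - apply is_Laplace_Cmult_l, Hbiv, Hsin. }
assert (Hzero : is_Laplace (fun _ => 0%C) s 0%C).
{ assert (L0 := is_Laplace_Cmult_l _ _ _ 0%C Hscal).
  rewrite Cmult_0_l in L0. revert L0. apply is_Laplace_ext. intros t _. ring. }
match goal with |- is_Laplace_Cl _ _ ?v => assert (Ev : v = mkCl X1 0 0 (RtoC lam * X2)) end.
{ transitivity (cl_plus (cl_of_C X1) (cl_mult (wedge x y) (cl_of_C X2)));
    [| apply cl_scalar_bivector]. f_equal. unfold cl_plus, cl_of_C, X1, P; simpl. f_equal; ring. }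
rewrite Ev.
assert (Ek : forall t, K2 n nt x y t =
          mkCl (K2_scal n nt z theta t) 0 0 (RtoC lam * K2_biv n nt z theta t))
  by (intros t; apply cl_scalar_bivector).
split; [| split; [| split]].
- revert Hscal. apply is_Laplace_ext. intros t _. rewrite Ek. reflexivity.
- revert Hzero. apply is_Laplace_ext. intros t _. rewrite Ek. reflexivity.
- revert Hzero. apply is_Laplace_ext. intros t _. rewrite Ek. reflexivity.
- revert Hbiv'. apply is_Laplace_ext. intros t _. rewrite Ek. reflexivity.
Qed.
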